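(* Let $(S,\preceq,\lambda)$ be a standard poset, let $\boldsymbol{X}=(X_1,X_2,\ldots)$ be an IID sequence in $S$ with common upper probability function $F$, and let $\boldsymbol{Y}=(Y_1,Y_2,\ldots)$ be the corresponding sequence of ladder variables. If the common distribution has constant rate $\alpha$, then: 1. $\boldsymbol{Y}$ is a homogeneous Markov chain on $S$ with transition probability density (with respect to $\lambda$) $g(y,z)=\alpha\,\dfrac{F(z)}{F(y)}$ for $y\preceq z$. 2. $(Y_1,\ldots,Y_n)$ has PDF (with respect to $\lambda^n$) $g_n(y_1,\ldots,y_n)=\alpha^n F(y_n)$ for $(y_1,\ldots,y_n)\in D_n$. 3. $Y_n$ has PDF $f_n(y)=\alpha^n\lambda_{n-1}(y)F(y)$, $y\in S$. 4. The conditional distribution of $(Y_1,\ldots,Y_{n-1})$ given $Y_n=y$ is uniform on $D_{n-1}[y]$ (for $n\ge 2$).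
   Context: For a poset $(S,\preceq)$ let $I[x]=\{t\in S: t\succeq x\}$, $D[x]=\{t\in S: t\preceq x\}$, $D_n=\{(x_1,\ldots,x_n)\in S^n: x_1\preceq\cdots\preceq x_n\}$ and $D_n[x]=\{(x_1,\ldots,x_n)\in S^n: x_1\preceq\cdots\preceq x_n\preceq x\}$. A standard poset $(S,\preceq,\lambda)$ is a poset with a topology and a Borel measure such that: $S$ is locally compact, locally convex (every point has a neighborhood base of convex sets, where $A$ is convex if $a,b\in A$, $a\preceq x\preceq b$ imply $x\in A$) and has a countable base; $D_2$ is closed in $S^2$; $D[x]$ is compact for each $x\in S$; $\lambda$ is a positive Borel measure, finite on compact sets, with $\lambda(V)>0$ for every nonempty open $V$. PDFs on $S$ are with respect to $\lambda$, and on $S^n$ with respect to the product measure $\lambda^n$; densities are $0$ outside the indicated sets. Random variables $X$ in $S$ have a Borel distribution with support $S$; the upper probability function (UPF) is $F(x)=\mathbb{P}(X\succeq x)$, assumed to take values in $(0,1]$. The distribution has constant rate $\alpha>0$ if $\alpha F$ is a PDF of $X$. The cumulative functions are $\lambda_0=1$ and $\lambda_n(x)=\lambda^n(D_n[x])$ for $n\ge1$. Ladder variables: $N_1=1$, $Y_1=X_1$, and recursively $N_{n+1}=\min\{k>N_n: X_k\succeq Y_n\}$, $Y_{n+1}=X_{N_{n+1}}$. ''Uniform on $D_{n-1}[y]$'' means having constant density $1/\lambda_{n-1}(y)$ with respect to $\lambda^{n-1}$ on $D_{n-1}[y]$; as usual this is understood for almost every $y$ with respect to the distribution of $Y_n$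 (in particular for $y$ with $\lambda_{n-1}(y)>0$). *)

(* Defs.v *)
From HB Require Import structures.
From mathcomp Require Import all_boot all_order all_algebra finmap.
From mathcomp Require Import all_classical all_reals all_analysis.
From mathcomp Require Import measurable_realfun.

Set Implicit Arguments.
Unset Strict Implicit.
Unset Printing Implicit Defensive.

Import Order.TTheory GRing.Theory Num.Theory.
Import numFieldNormedType.Exports.

Local Open Scope classical_set_scope.
Local Open Scope ring_scope.

(* A partially ordered topological space; the library only asks that order and
   topology live on the same type. *)
Notation poTopType d := (POrderedPointedTopological.type d).

(* [S] with its Borel sigma-algebra.  The sigma-algebra of [n.-tuple (borel S)]
   is the product one, which is the Borel sigma-algebra of S^n when [S] is second
   countable. *)
Notation borel S := (g_sigma_algebraType (@open S)).

Section standard_poset.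
Context {d : Order.disp_t} {S : poTopType d} {R : realType}.

Definition order_convex (A : set S) : Prop :=
  forall a b x : S, A a -> A b -> (a <= x)%O -> (x <= b)%O -> A x.

Record standard_poset (lam : {measure set (borel S) -> \bar R}) : Prop := {
  std_locally_compact : locally_compact [set: S] ;
  std_locally_convex : forall (x : S) (U : set S), nbhs x U ->
    exists V : set S, [/\ nbhs x V, order_convex V & V `<=` U] ;
  std_second_countable : @second_countable S ;
  std_closed_order : closed [set p : S * S | (p.1 <= p.2)%O] ;
  std_compact_down : forall x : S, compact [set t : S | (t <= x)%O] ;
  std_finite_compact : forall K : set S, compact K -> (lam K < +oo)%E ;
  std_pos_open : forall V : set S, open V -> V !=set0 -> (0 < lam V)%E
}.

Definition chain (n : nat) : set (n.-tuple (borel S)) :=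
  [set t | sorted (<=%O : rel S) t].

Definition chain_below (n : nat) (x : S) : set (n.-tuple (borel S)) :=
  [set t | sorted (<=%O : rel S) (rcons t x)].

End standard_poset.
Arguments chain {d S} n _ : simpl never.
Arguments chain_below {d S} n x _ : simpl never.

(* The n-fold product of [lam] on tuples: iterate the library's binary product
   [\x], which is a measure when [lam] is sigma-finite (as it is for a locally
   finite measure on a second countable locally compact space). *)
Fixpoint product_power {d} {T : measurableType d} {R : realType}
    (lam : set T -> \bar R) (n : nat) : set (n.-tuple T) -> \bar R :=
  match n return set (n.-tuple T) -> \bar R with
  | 0 => dirac [tuple]
  | m.+1 => pushforward (lam \x @product_power d T R lam m)%E
              (fun p : T * m.-tuple T => [tuple of p.1 :: p.2])
  end.
Arguments product_power {d T R} lam n.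

Section cumulative.
Context {d : Order.disp_t} {S : poTopType d} {R : realType}.

Definition poset_cumulative (lam : set (borel S) -> \bar R) (n : nat) (x : S) : \bar R :=
  product_power lam n (chain_below n x).

Lemma poset_cumulative0 (lam : set (borel S) -> \bar R) (x : S) :
  poset_cumulative lam 0 x = 1%E.
Proof.
by rewrite /poset_cumulative /= diracE mem_set.
Qed.

Definition measure_support (Q : set (borel S) -> \bar R) : set S :=
  [set x | forall V : set S, open V -> V x -> (0 < Q V)%E].

(* [fine] loses nothing: probabilities are finite. *)
Definition upf (Q : probability (borel S) R) (x : S) : R :=
  fine (Q [set t : S | (x <= t)%O]).

End cumulative.

Section laws.
Context {R : realType}.

Definition is_pdf {d} {T : measurableType d}
    (mu Q : set T -> \bar R) (f : T -> \bar R) : Prop :=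
  [/\ measurable_fun [set: T] f,
      forall x, (0 <= f x)%E &
      forall A, measurable A -> Q A = (\int[mu]_(x in A) f x)%E].

Context {d'} {Omega : measurableType d'} (P : probability Omega R).

Definition has_pdf {d} {T : measurableType d}
    (V : Omega -> T) (mu : set T -> \bar R) (f : T -> \bar R) : Prop :=
  measurable_fun [set: Omega] V /\ is_pdf mu (pushforward P V) f.

(* [k z] is (a version of) the conditional distribution of [V] given [Z = z]. *)
Definition cond_distribution {d1 d2} {T1 : measurableType d1}
    {T2 : measurableType d2} (V : Omega -> T1) (Z : Omega -> T2)
    (k : T2 -> set T1 -> \bar R) : Prop :=
  [/\ measurable_fun [set: Omega] V, measurable_fun [set: Omega] Z,
      forall A, measurable A -> measurable_fun [set: T2] (k ^~ A) &
      forall A B, measurable A -> measurable B ->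
        P (V @^-1` A `&` Z @^-1` B) = (\int[pushforward P Z]_(z in B) k z A)%E].

Context {d} {T : measurableType d}.

Definition mutually_independent (X : nat -> Omega -> T) : Prop :=
  forall (J : {fset nat}) (A : nat -> set T), (forall i, measurable (A i)) ->
    P (\bigcap_(i in [set` J]) (X i @^-1` A i)) =
    (\prod_(i <- J) P (X i @^-1` A i))%E.

Definition iid (X : nat -> {RV P >-> T}) (Q : probability T R) : Prop :=
  mutually_independent (fun i => X i) /\
  forall i A, measurable A -> distribution P (X i) A = Q A.

Definition initial_tuple (Y : nat -> Omega -> T) (n : nat) (w : Omega) :
  n.-tuple T := [tuple Y i w | i < n].

Definition homogeneous_markov_chain (Y : nat -> Omega -> T)
    (K : R.-pker T ~> T) : Prop :=
  forall n, cond_distribution (Y n.+1) (initial_tuple Y n.+1)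
              (fun t => K (tnth t ord_max)).

End laws.

Definition constant_rate {d} {S : poTopType d} {R : realType}
    (lam : set (borel S) -> \bar R) (Q : probability (borel S) R) (alpha : R) :
    Prop :=
  0 < alpha /\ is_pdf lam Q (fun x => (alpha * upf Q x)%:E).

Section ladder.
Context {d : Order.disp_t} {S : poTopType d}.

(* The least element of [p], and [k] if there is none. *)
Definition least_index (p : pred nat) (k : nat) : nat :=
  if pselect (exists j, p j) is left h then ex_minn h else k.

(* Sequences are indexed from 0: [x 0] is the first term and [ladder_index x 0]
   the index of the first ladder variable.  The recursion stops moving if no
   later term dominates the current one; this is a null event as soon as the
   terms are IID with a positive upper probability function. *)
Fixpoint ladder_index (x : nat -> S) (n : nat) : nat :=
  if n is m.+1 then
    let k := ladder_index x m in
    least_index (fun j => (k < j)%N && (x k <= x j)%O) k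
  else 0.

Definition ladder {Omega : Type} (X : nat -> Omega -> S) (n : nat) (w : Omega) :
    S :=
  X (ladder_index (X ^~ w) n) w.

End ladder.

(* The library's [f \_ D] defaults to [point]; the default here is 0. *)
Definition density_on {T : Type} {R : realType} (D : set T) (f : T -> \bar R) :
  T -> \bar R := patch (fun=> 0%E) D f.

(* Main.v *)
Require Import Defs.
From HB Require Import structures.
From mathcomp Require Import all_boot all_order all_algebra finmap.
From mathcomp Require Import all_classical all_reals all_analysis.
From mathcomp Require Import measurable_realfun.

Set Implicit Arguments.
Unset Strict Implicit.
Unset Printing Implicit Defensive.

Import Order.TTheory GRing.Theory Num.Theory.
Import numFieldNormedType.Exports.

Local Open Scope classical_set_scope.
Local Open Scope ring_scope.


(** Write [F] for the upper probability function and [I[y]] for the set of the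
points above [y].  Once the current ladder value is [y], each later term lies
above [y] with probability [F y], independently of the past, and [F y] is
positive.  So the wait for the next ladder value is almost surely finite, and the
term that ends it has the law [Q] of the terms conditioned on [I[y]].  The ladder
variables are thus a Markov chain with kernel [Q (A `&` I[y]) / F y], which under
a constant rate has density [alpha * F z / F y].  Along a chain the initial
density [alpha * F y0] and the transition densities telescope to a power of
[alpha] times [F] of the last entry.  That density depends on the last entry
only: integrating the other entries out gives the cumulative function, and
conditioning on the last entry leaves the uniform law.

The Markov property ([ladder_transition]) is proved without stopping times or
geometric series, by adding up one-step identities at deterministic times.  Call
[current_rank n k] the event that exactly [n] ladder values after the first one
occur up to time [k].  The past up to [k] is independent of the next term, so the
part of [E f(Y_0, ..., Y_{n+1})] where the jump to rank [n+1] happens at time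
[k+1] is the integral of [f] against [Q] on [I[Y_n]], over [current_rank n k]
([ladder_step]).  Summing over [k] ([ladder_sum_steps]) yields an unknown total
weight, the time spent at rank [n].  The same formula for a function of
[Y_0, ..., Y_n] alone ([ladder_sum_sojourns]) says that this weight, multiplied by
[F Y_n], averages to 1; comparing both removes it and leaves the factor
[1 / F Y_n].

Rank [n+1] is almost surely reached ([negligible_not_reached]): on the event of
being stuck at rank [n] from some time on, the integral of [F Y_n] is at most the
probability of a jump at any later time, and these probabilities tend to 0
because the jumps at distinct times are disjoint.

Two facts let Tonelli's theorem apply throughout: the order is measurable for the
product sigma-algebra, by second countability ([measurable_order]), and the
reference measure is sigma-finite, because it has finite mass where
[alpha * F] is bounded below ([constant_rate_sigma_finite]). *)

Local Notation le_graph S :=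
  [set p : borel S * borel S | ((p.1 : S) <= p.2)%O].

(** * Densities, sigma-finite measures and conditioning *)

Lemma measurable_fun_inv_ge0 d (T : measurableType d) (R : realType)
    (f : T -> R) :
  measurable_fun [set: T] f -> (forall x, 0 <= f x) ->
  measurable_fun [set: T] (fun x => (f x)^-1).
Proof.
move=> mf f0; rewrite (_ : (fun x => _) = (@powR R ^~ (-1)) \o f).
  by apply: measurableT_comp => //; exact: measurable_powR.
by apply/funext => x; rewrite /= powR_inv1.
Qed.

Section density.
Local Open Scope ereal_scope.
Context d d' (Omega : measurableType d) (T : measurableType d') (R : realType).
Variables (P : {measure set Omega -> \bar R}) (V : Omega -> T).
Hypothesis mV : measurable_fun [set: Omega] V.
Import HBNNSimple.

(** Holds for indicators by definition of a density, then for simple functions by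
linearity and for [h >= 0] by monotone convergence.  Finiteness of [f] makes
multiplication by [f x] continuous at [+oo]. *)
Lemma integral_pdf (mu : {measure set T -> \bar R}) (f h : T -> \bar R) :
  is_pdf mu (pushforward P V) f -> (forall x, f x \is a fin_num) ->
  measurable_fun [set: T] h -> (forall x, 0 <= h x) ->
  \int[P]_w h (V w) = \int[mu]_x (h x * f x).
Proof.
move=> [mf f0 QE] ffin mh h0.
pose h_ := nnsfun_approx measurableT mh.
have mh_ (n : nat) : measurable_fun [set: T] (fun x => (h_ n x)%:E).
  exact/measurable_EFinP/measurable_funP.
have mhV (n : nat) : measurable_fun [set: Omega] (fun w => (h_ n (V w))%:E).
  exact: (measurableT_comp (mh_ n)).
have mhf (n : nat) : measurable_fun [set: T] (fun x => (h_ n x)%:E * f x).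
  exact: emeasurable_funM.
have hE x : h x * f x = limn (fun n => (h_ n x)%:E * f x).
  apply/esym/cvg_lim => //.
  by apply: cvgeZr; [exact: ffin | exact: cvg_nnsfun_approx].
rewrite [RHS](_ : _ = limn (fun n => \int[mu]_x ((h_ n x)%:E * f x)));
  last first.
  rewrite -monotone_convergence//.
  - by apply: eq_integral => x _; rewrite hE.
  - by move=> n x _; rewrite mule_ge0// lee_fin.
  - move=> x _ m n mn; rewrite lee_wpmul2r// lee_fin.
    exact/lefP/nd_nnsfun_approx.
transitivity (limn (fun n => \int[P]_w (h_ n (V w))%:E)).
  rewrite -monotone_convergence//.
  - apply: eq_integral => w _; apply/esym/cvg_lim => //.
    exact: cvg_nnsfun_approx.
  - by move=> n w _; rewrite lee_fin.
  - by move=> w _ m n mn; rewrite lee_fin; exact/lefP/nd_nnsfun_approx.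
congr (limn _); apply/funext => n.
have mi r : measurable_fun [set: T]
    (fun x => (\1_(h_ n @^-1` [set r]) x)%:E : \bar R).
  exact/measurable_EFinP.
transitivity (\sum_(r \in range (h_ n))
    \int[P]_w (r * \1_(h_ n @^-1` [set r]) (V w))%:E).
  under eq_integral do rewrite fimfunE -fsumEFin//.
  rewrite ge0_integral_fsum//.
  - move=> r; apply/measurable_EFinP/measurable_funM => //.
    exact/measurable_EFinP/(measurableT_comp (mi r)).
  - by move=> r w _; rewrite nnfun_muleindic_ge0.
transitivity (\sum_(r \in range (h_ n))
    \int[mu]_x ((r * \1_(h_ n @^-1` [set r]) x)%:E * f x)).
  apply: eq_fsbigr => r /[!inE] -[t _ <-].
  have ht : 0 <= (h_ n t)%:E by rewrite lee_fin.
  under [RHS]eq_integral do rewrite EFinM -muleA.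
  under [LHS]eq_integral do rewrite EFinM.
  rewrite !ge0_integralZl//; last 3 first.
  - exact: emeasurable_funM.
  - by move=> x _; rewrite mule_ge0.
  - exact: (measurableT_comp (mi _)).
  congr (_ * _).
  transitivity (pushforward P V (h_ n @^-1` [set h_ n t])).
    rewrite /pushforward -[X in _ = P X]setIT -integral_indic//.
    by rewrite -[X in measurable X]setTI; exact: mV.
  rewrite QE// integral_mkcond.
  apply: eq_integral => x _; rewrite patchE indicE.
  by case: ifPn; rewrite ?mul1e// mul0e.
rewrite -ge0_integral_fsum//.
- apply: eq_integral => x _; rewrite [X in _ = X%:E * _]fimfunE -fsumEFin//.
  by rewrite ge0_mule_fsuml// => r; rewrite nnfun_muleindic_ge0.
- move=> r; apply: emeasurable_funM => //.
  by exact/measurable_EFinP/measurable_funM.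
- by move=> r x _; rewrite mule_ge0// nnfun_muleindic_ge0.
Qed.

End density.

Section sigma_finite_structure.
Local Open Scope ereal_scope.
Context d (T : measurableType d) (R : realType) (mu : {measure set T -> \bar R}).
Hypothesis mu_sf : sigma_finite [set: T] mu.

(** A name that carries the proof of sigma-finiteness, on which the structure of
sigma-finite measure can be declared. *)
Definition sf_measure (_ : sigma_finite [set: T] mu) : set T -> \bar R := mu.

HB.instance Definition _ := Measure.copy (sf_measure mu_sf) mu.

Let sf_measure_sigma_finite : sigma_finite [set: T] (sf_measure mu_sf).
Proof. exact: mu_sf. Qed.

HB.instance Definition _ :=
  @Measure_isSigmaFinite.Build _ _ _ (sf_measure mu_sf) sf_measure_sigma_finite.

End sigma_finite_structure.

Section conditioning_kernel.
Local Open Scope ereal_scope.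
Context d1 d2 (T1 : measurableType d1) (T2 : measurableType d2) (R : realType).
Variables (mu : {sigma_finite_measure set T2 -> \bar R}) (C : set (T1 * T2)).
Hypothesis mC : measurable C.

Definition section_kernel (x : T1) : {measure set T2 -> \bar R} :=
  mrestr mu (measurable_xsection x mC).

Let measurable_section_kernel U :
  measurable U -> measurable_fun [set: T1] (section_kernel ^~ U).
Proof.
move=> mU; rewrite (_ : (fun x => _) = mu \o xsection (C `&` (setT `*` U))).
  by apply: measurable_fun_xsection; apply: measurableI => //; exact: measurableX.
apply/funext => x; rewrite /= /mrestr xsectionI setIC; congr (mu (_ `&` _)).
by apply/seteqP; split => y; rewrite /xsection/= inE => // -[].
Qed.

HB.instance Definition _ :=
  isKernel.Build _ _ _ _ R section_kernel measurable_section_kernel.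

Variable p0 : probability T2 R.

(** Conditioning [mu] on the section of [C] at [x]; [p0] takes over at the points
[x] where that section is null or has infinite mass. *)
Definition conditioning_kernel : R.-pker T1 ~> T2 :=
  knormalize section_kernel p0.

Lemma conditioning_kernelE x A : 0 < mu (xsection C x) < +oo ->
  conditioning_kernel x A =
  ((fine (mu (xsection C x)))^-1)%:E * mu (A `&` xsection C x).
Proof.
move=> /andP[C0 Coo].
rewrite /conditioning_kernel/= /knormalize/= /mnormalize/= /mrestr setTI.
by rewrite gt_eqF//= lt_eqF// muleC.
Qed.

Lemma conditioning_kernel_pdf x : 0 < mu (xsection C x) < +oo ->
  is_pdf mu (conditioning_kernel x)
    (density_on (xsection C x) (fun=> ((fine (mu (xsection C x)))^-1)%:E)).
Proof.
move=> Cx; have mCx := measurable_xsection x mC.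
have c0 : (0 <= (fine (mu (xsection C x)))^-1)%R by rewrite invr_ge0 fine_ge0.
split.
- by apply/(measurable_restrictT _ mCx).
- by move=> y; rewrite /density_on patchE; case: ifP.
- move=> A mA; rewrite conditioning_kernelE// -integral_mkcondr.
  by rewrite (integral_cst mu _ (_)%:E)//; exact: measurableI.
Qed.

End conditioning_kernel.

(** * Powers of a measure on tuples *)

Section product_power.
Local Open Scope ereal_scope.
Context d (T : measurableType d) (R : realType).

Definition tcons n (p : T * n.-tuple T) : n.+1.-tuple T :=
  [tuple of p.1 :: p.2].

Lemma measurable_tcons n : measurable_fun [set: T * n.-tuple T] (@tcons n).
Proof. exact: measurable_cons. Qed.

Definition trcons n (p : n.-tuple T * T) : n.+1.-tuple T :=
  [tuple of rcons p.1 p.2].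

Lemma tnth_trcons_last n (p : n.-tuple T * T) : tnth (trcons p) ord_max = p.2.
Proof. by rewrite (tnth_nth p.2)/= nth_rcons size_tuple ltnn eqxx. Qed.

Lemma tnth_trcons_lt n (p : n.-tuple T * T) (i : 'I_n.+1) (lin : (i < n)%N) :
  tnth (trcons p) i = tnth p.1 (Ordinal lin).
Proof. by rewrite !(tnth_nth p.2)/= nth_rcons size_tuple lin. Qed.

Lemma measurable_trcons n : measurable_fun [set: n.-tuple T * T] (@trcons n).
Proof.
apply/measurable_fun_tnthP => i /=.
case: (ltnP i n) => [lin|lni].
  rewrite (_ : _ \o _ = (fun t => tnth t (Ordinal lin)) \o fst); last first.
    by apply/funext => p /=; rewrite tnth_trcons_lt.
  by apply: measurableT_comp => //; exact: measurable_tnth.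
rewrite (_ : _ \o _ = snd)//; apply/funext => p /=.
rewrite (_ : i = ord_max) ?tnth_trcons_last//; apply/val_inj => /=.
by apply/eqP; rewrite eqn_leq lni -ltnS ltn_ord.
Qed.

(** One step of the product power, between sigma-finite measures; iterating it
gives the product power the structure which Tonelli's theorem asks for. *)
Section cons_measure.
Variables (lam : {sigma_finite_measure set T -> \bar R}) (n : nat).
Variable mu : {sigma_finite_measure set (n.-tuple T) -> \bar R}.

Definition cons_measure : set (n.+1.-tuple T) -> \bar R :=
  pushforward (lam \x mu) (@tcons n).

Let m0 : cons_measure set0 = 0.
Proof. by rewrite /cons_measure /pushforward preimage_set0 measure0. Qed.

Let m_ge0 A : 0 <= cons_measure A.
Proof. by rewrite /cons_measure /pushforward measure_ge0. Qed.

Let m_sigma_additive : semi_sigma_additive cons_measure.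
Proof.
move=> F mF tF mUF; rewrite /cons_measure /pushforward preimage_bigcup.
apply: measure_semi_sigma_additive.
- by move=> k; rewrite -[X in measurable X]setTI; exact: measurable_tcons.
- apply/trivIsetP => /= i j _ _ ij; rewrite -preimage_setI.
  by move/trivIsetP : tF => /(_ _ _ _ _ ij) ->//; rewrite preimage_set0.
- by rewrite -preimage_bigcup -[X in measurable X]setTI; exact: measurable_tcons.
Qed.

HB.instance Definition _ := isMeasure.Build _ _ _ cons_measure
  m0 m_ge0 m_sigma_additive.

Let m_sigma_finite : sigma_finite [set: n.+1.-tuple T] cons_measure.
Proof.
have /sigma_finiteP[F [TF ndF Foo]] := sigma_finiteT lam.
have /sigma_finiteP[G [TG ndG Goo]] := sigma_finiteT mu.
pose split_tuple (t : n.+1.-tuple T) := (thead t, [tuple of behead t]).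
exists (fun k => split_tuple @^-1` (F k `*` G k)).
  rewrite -preimage_bigcup -(preimage_setT split_tuple); congr (_ @^-1` _).
  apply/esym; rewrite -setXTT TF TG; apply/seteqP; split => -[x y].
    by move=> [k _ []/= ? ?]; split; exists k.
  move=> [/= [k _ Fx] [l _ Gy]]; exists (maxn k l) => //; split.
  - by move: x Fx; exact/subsetPset/ndF/leq_maxl.
  - by move: y Gy; exact/subsetPset/ndG/leq_maxr.
move=> k; have [mF Fk] := Foo k; have [mG Gk] := Goo k; split.
  rewrite -[X in measurable X]setTI; apply: measurable_fun_pair => //.
  - exact: measurable_tnth.
  - exact: measurable_behead.
  - exact: measurableX.
rewrite /cons_measure /pushforward.
rewrite (_ : _ @^-1` _ = F k `*` G k); last first.
  have split_tcons : split_tuple \o @tcons n = id.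
    by apply/funext => -[x t]; congr pair; exact: val_inj.
  by rewrite -[LHS]/((split_tuple \o @tcons n) @^-1` _) split_tcons.
by rewrite [ltLHS]product_measure1E// lte_mul_pinfty// ge0_fin_numE.
Qed.

HB.instance Definition _ := @Measure_isSigmaFinite.Build _ _ _ cons_measure
  m_sigma_finite.

End cons_measure.

Variable lam : {sigma_finite_measure set T -> \bar R}.

Fixpoint power_measure n : {sigma_finite_measure set (n.-tuple T) -> \bar R} :=
  match n with
  | 0 => @dirac _ (0.-tuple T) [tuple] R
  | m.+1 => cons_measure lam (power_measure m)
  end.

Lemma power_measureE n :
  (power_measure n : set (n.-tuple T) -> \bar R) = product_power lam n.
Proof. by elim: n => //= n <-. Qed.

Lemma integral_power_cons n (f : n.+1.-tuple T -> \bar R) :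
  measurable_fun setT f -> (forall t, 0 <= f t) ->
  \int[power_measure n.+1]_t f t =
  \int[lam]_x \int[power_measure n]_t f (tcons (x, t)).
Proof.
move=> mf f0 /=.
rewrite ge0_integral_pushforward//; last exact: measurable_tcons.
rewrite preimage_setT fubini_tonelli1//; last by move=> p; exact: f0.
by apply: measurableT_comp => //; exact: measurable_tcons.
Qed.

(** The product power adds entries in front while the ladder variables arrive at
the end.  Both iterated integrals run over the entries in the same order, so that
the identity follows by unfolding, without exchanging integrals. *)
Lemma integral_power_rcons n (f : n.+1.-tuple T -> \bar R) :
  measurable_fun setT f -> (forall t, 0 <= f t) ->
  \int[power_measure n.+1]_t f t =
  \int[power_measure n]_t \int[lam]_x f (trcons (t, x)).
Proof.
have mg k (g : k.+1.-tuple T -> \bar R) : measurable_fun setT g ->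
    (forall t, 0 <= g t) ->
    measurable_fun setT (fun t => \int[lam]_x g (trcons (t, x))).
  move=> mg g0; apply: (measurable_fun_fubini_tonelli_F (g \o @trcons k)) => //.
    by apply: measurableT_comp => //; exact: measurable_trcons.
  by move=> ?; exact: g0.
elim: n f => [|n IH] f mf f0.
  rewrite integral_power_cons// [RHS]integral_dirac//=; last exact: mg.
  rewrite diracT mul1e; apply: eq_integral => x _.
  rewrite integral_dirac//= ?diracT ?mul1e; first by congr f; exact: val_inj.
  by apply: (measurableT_comp mf); exact: (measurableT_comp (@measurable_tcons _)).
rewrite integral_power_cons// integral_power_cons//; last 2 first.
- exact: mg.
- by move=> t; exact: integral_ge0.
apply: eq_integral => x _; rewrite (IH (fun t => f (tcons (x, t)))).
- apply: eq_integral => t _; apply: eq_integral => s _.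
  by congr f; exact: val_inj.
- by apply: (measurableT_comp mf); exact: (measurableT_comp (@measurable_tcons _)).
- by move=> t; exact: f0.
Qed.

End product_power.

Lemma integral_power1 d (T : measurableType d) (R : realType)
    (lam : {sigma_finite_measure set T -> \bar R}) (f : 1.-tuple T -> \bar R) :
  measurable_fun setT f -> (forall t, 0 <= f t)%E ->
  (\int[power_measure lam 1]_t f t = \int[lam]_x f (trcons ([tuple], x)))%E.
Proof.
move=> mf f0; rewrite integral_power_rcons// integral_dirac//=.
  by rewrite diracT mul1e.
apply: (measurable_fun_fubini_tonelli_F (f \o @trcons _ T 0)) => [|p].
  by apply: measurableT_comp => //; exact: measurable_trcons.
exact: f0.
Qed.

(** * Measurability of the order and of chains *)

Lemma countable_bigcup_measurable d (T : sigmaRingType d) (I : Type)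
    (D : set I) (F : I -> set T) :
  countable D -> (forall i, D i -> measurable (F i)) ->
  measurable (\bigcup_(i in D) F i).
Proof.
move=> cD mF; rewrite bigcup_set_type.
apply: countable_bigcupT_measurable => [|i]; last exact/mF/set_mem/valP.
by rewrite /countable (card_le_eql (card_setT _)).
Qed.

Section order_measurable.
Context {d : Order.disp_t} {S : poTopType d}.

(** The complement of the graph of the order is open, hence a union of rectangles
with sides in a countable basis. *)
Lemma measurable_order : @second_countable S ->
  closed [set p : S * S | (p.1 <= p.2)%O] ->
  measurable (le_graph S).
Proof.
move=> [B cB [Bopen Bbasis]] cle.
set D := [set p | _].
pose I := [set VW : set S * set S |
  (B `*` B) VW /\ VW.1 `*` VW.2 `<=` ~` [set p : S * S | (p.1 <= p.2)%O]].
have DE : D = ~` \bigcup_(VW in I) (VW.1 `*` VW.2).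
  apply/seteqP; split => -[x y].
    by move=> xy [[V W] [_ /(_ (x, y)) VW] Vx]; exact: (VW Vx).
  move=> /= nI; apply: contrapT => nxy; apply: nI.
  have : nbhs (x, y) (~` [set p : S * S | (p.1 <= p.2)%O]).
    by apply: open_nbhs_nbhs; split => //; exact: closed_openC.
  move=> [[V W] /= [Vx Wy] VW].
  have [V' [BV' V'x] V'V] := Bbasis x _ Vx.
  have [W' [BW' W'y] W'W] := Bbasis y _ Wy.
  exists (V', W') => //; split=> // -[a b] [/= V'a W'b].
  by apply: (VW (a, b)); split; [exact: V'V | exact: W'W].
rewrite DE; apply: measurableC; apply: countable_bigcup_measurable.
  by apply: (sub_countable _ (countableX cB cB)); apply: subset_card_le => ? [].
move=> [V W] [[/= BV BW] _]; apply: measurableX; apply: sub_sigma_algebra.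
- exact: Bopen.
- exact: Bopen.
Qed.

Hypothesis mle : measurable (le_graph S).

Lemma measurable_le_fun d' (T : measurableType d') (f g : T -> borel S) :
  measurable_fun setT f -> measurable_fun setT g ->
  measurable [set t | ((f t : S) <= g t)%O].
Proof.
move=> mf mg.
rewrite -[X in measurable X]setTI.
exact: (measurable_fun_pair mf mg measurableT mle).
Qed.

Lemma measurable_chain n : measurable (@chain _ S n).
Proof.
rewrite (_ : chain n = \bigcap_(i in [set: 'I_n]) \bigcap_(j in [set: 'I_n])
   [set t : n.-tuple (borel S) | i.+1 = j -> ((tnth t i : S) <= tnth t j)%O]).
  apply: fin_bigcap_measurable => // i _.
  apply: fin_bigcap_measurable => // j _.
  have [ij|ij] := eqVneq i.+1 (j : nat).
    rewrite (_ : mkset _ = [set t | ((tnth t i : S) <= tnth t j)%O]).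
      by apply: measurable_le_fun; exact: measurable_tnth.
    by apply/seteqP; split => t //= /(_ ij).
  rewrite (_ : mkset _ = setT)//.
  by apply/seteqP; split => t //= _ /eqP; rewrite (negbTE ij).
apply/seteqP; split => t.
  move=> st i _ j _ /= ij; rewrite !(tnth_nth point) -ij.
  by apply: (sortedP _ st); rewrite size_tuple ij.
move=> H; case: n t H => [|n] t H; first by rewrite (tuple0 t).
apply/(sortedP point) => i; rewrite size_tuple => iln.
have := H (Ordinal (ltnW iln)) I (Ordinal iln) I erefl.
by rewrite !(tnth_nth point).
Qed.

Lemma chain_trcons n (t : n.+1.-tuple (borel S)) (x : S) :
  chain n.+2 (trcons (t, x : borel S)) <->
  chain n.+1 t /\ ((tnth t ord_max : S) <= x)%O.
Proof.
case/tupleP: t => a u; rewrite /chain/= rcons_path.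
have -> : tnth [tuple of a :: u] ord_max = last a u.
  by rewrite (tnth_nth a)/= -[X in nth _ _ X](size_tuple u) nth_last.
by split => [/andP[]|[-> ->]].
Qed.

Lemma measurable_chain_below n (x : S) : measurable (@chain_below _ S n x).
Proof.
have mr : measurable_fun setT
    (fun t : n.-tuple (borel S) => trcons (t, x : borel S)).
  by apply: measurableT_comp; [exact: measurable_trcons|exact: measurable_fun_pair].
rewrite -[X in measurable X]setTI.
by apply: (mr measurableT (chain n.+1)); exact: measurable_chain.
Qed.

End order_measurable.

(** The family of the sets [chain_below n x] as one subset of a product: its
measurability gives that of their measure as a function of [x]. *)
Definition chain_below_graph {d : Order.disp_t} {S : poTopType d} (n : nat) :
    set (borel S * n.-tuple (borel S)) :=
  [set p | chain_below n (p.1 : S) p.2].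
Arguments chain_below_graph {d S} n _ : simpl never.

Section chain_below_relation.
Context {d : Order.disp_t} {S : poTopType d}.
Hypothesis mle : measurable (le_graph S).

Lemma measurable_chain_below_graph n : measurable (@chain_below_graph _ S n).
Proof.
have mt : measurable_fun [set: borel S * n.-tuple (borel S)]
    (fun p => trcons (p.2, p.1)).
  by apply: measurableT_comp; [exact: measurable_trcons|exact: measurable_fun_pair].
rewrite -[X in measurable X]setTI.
by apply: (mt measurableT (chain n.+1)); exact: measurable_chain.
Qed.

Lemma xsection_chain_below n (x : borel S) :
  xsection (chain_below_graph n) x = chain_below n (x : S).
Proof. by apply/seteqP; split => t; rewrite /xsection/= inE. Qed.

End chain_below_relation.

Section cumulative_finite.
Local Open Scope ereal_scope.
Context {R : realType} {d : Order.disp_t} {S : poTopType d}.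
Hypothesis mle : measurable (le_graph S).
Context (lam : {sigma_finite_measure set (borel S) -> \bar R}).
Hypothesis lam_down : forall x : S, lam [set t : S | (t <= x)%O] < +oo.

(** A chain below [x] has its first entry below [x] and its other entries form a
chain below [x], so each entry costs at most a factor [lam {t | t <= x}]. *)
Lemma cumulative_lty n (x : S) : power_measure lam n (chain_below n x) < +oo.
Proof.
elim: n => [|n IH].
  rewrite /= (le_lt_trans (probability_le1 _ _)) ?ltry//.
  exact: measurable_chain_below.
have mdown : measurable [set t : borel S | ((t : S) <= x)%O].
  exact: (measurable_le_fun mle (g := cst (x : borel S))).
have mchain := @measurable_chain_below _ _ mle n x.
apply: (@le_lt_trans _ _ ((lam \x power_measure lam n)
    ([set t : borel S | ((t : S) <= x)%O] `*` chain_below n x))).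
  rewrite /= /cons_measure /pushforward le_measure// ?inE.
  - rewrite -[X in measurable X]setTI; apply: measurable_tcons => //.
    exact: measurable_chain_below.
  - exact: measurableX.
  move=> [y t]; rewrite /chain_below/= => yt.
  split => /=; last exact: path_sorted yt.
  have /allP := order_path_min le_trans yt; apply.
  by rewrite mem_rcons mem_head.
rewrite [ltLHS]product_measure1E// lte_mul_pinfty// ge0_fin_numE//.
exact: lam_down.
Qed.

End cumulative_finite.

(** * Record times of a deterministic sequence *)

Section records.
Context {d : Order.disp_t} {S : poTopType d}.
Implicit Type x : nat -> S.

(** The time of the last record among [x 0], ..., [x k], computed from these terms
alone.  [ladder_index], by contrast, looks into the future. *)
Fixpoint record_index x k : nat :=
  if k is m.+1 then
    if (x (record_index x m) <= x m.+1)%O then m.+1 else record_index x m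
  else 0.

Definition record_value x k : S := x (record_index x k).

(** The initial record [x 0] is not counted, so that a count of [n] means that the
current record is the ladder variable of index [n]. *)
Fixpoint record_count x k : nat :=
  if k is m.+1 then (record_count x m + (record_value x m <= x m.+1)%O)%N else 0.

(** The ladder variable of index [i] as known at time [k]: the record that stood
when the count was last at most [i].  Unlike the ladder variable itself it
depends only on the terms up to time [k]. *)
Fixpoint record_trace x i k : S :=
  if k is m.+1 then
    if (record_count x m.+1 <= i)%N then record_value x m.+1
    else record_trace x i m
  else x 0%N.

Lemma record_index_le x k : (record_index x k <= k)%N.
Proof. by elim: k => //= k IH; case: ifPn => // _; exact: leqW. Qed.

Lemma not_record x k i : (record_index x k < i <= k)%N ->
  ~~ (record_value x k <= x i)%O.
Proof.
rewrite /record_value; elim: k => [|k IH]/=; first by case: i.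
case: ifPn => [_|nle]; first by case: ltngtP.
case/andP => ji; rewrite leq_eqVlt => /predU1P[-> //|ik].
by apply: IH; rewrite ji.
Qed.

Lemma least_indexP (p : pred nat) k j :
  least_index p k = j <->
  (p j /\ forall i, (i < j)%N -> ~~ p i) \/ (j = k /\ forall i, ~~ p i).
Proof.
rewrite /least_index; case: pselect => [ex|nex].
  case: ex_minnP => m pm mle; split.
    move=> <-; left; split => // i im; apply/negP => /mle.
    by rewrite leqNgt im.
  move=> [[pj jle]|[_ np]]; last by rewrite (negbTE (np m)) in pm.
  apply/eqP; rewrite eqn_leq mle//= leqNgt; apply/negP => /jle.
  by rewrite pm.
split=> [<-|[[pj _]|[-> //]]]; last by exfalso; apply: nex; exists j.
by right; split => // i; apply/negP => pi; apply: nex; exists i.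
Qed.

(** No term between the last record and time [k] dominates that record, so a
record set at time [k+1] is the first term that does. *)
Lemma ladder_index_count x k :
  ladder_index x (record_count x k) = record_index x k.
Proof.
elim: k => //= k IH; rewrite /record_value.
case: ifPn => [le|nle]; last by rewrite addn0.
rewrite addn1/= IH; apply/least_indexP; left; split.
  by rewrite ltnS record_index_le.
move=> i; rewrite ltnS => ik; rewrite negb_and -implybE; apply/implyP => ji.
by apply: not_record; rewrite ji.
Qed.

Lemma record_traceE x i k : (i <= record_count x k)%N ->
  record_trace x i k = x (ladder_index x i).
Proof.
elim: k => [|k IH]; first by rewrite leqn0 => /eqP ->.
move=> ik; rewrite [record_trace _ _ _]/=.
case: (leqP (record_count x k.+1) i) => [ki|].
  by have -> : i = record_count x k.+1 by [apply/eqP; rewrite eqn_leq ik ki];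
     rewrite ladder_index_count.
move=> ik'; apply: IH; rewrite -ltnS; apply: leq_trans ik' _ => /=.
by rewrite -[leqRHS]addn1 leq_add2l leq_b1.
Qed.

Lemma record_count_homo x k l : (k <= l)%N ->
  (record_count x k <= record_count x l)%N.
Proof.
move=> /subnK <-; elim: (l - k)%N => // m IH.
by rewrite addSn (leq_trans IH)//= leq_addr.
Qed.

(** The count grows by at most one at each step, so it skips no value. *)
Lemma record_count_hits x n k : (n <= record_count x k)%N ->
  exists2 j, (j <= k)%N & record_count x j = n.
Proof.
elim: k => [|k IH]; first by rewrite leqn0 => /eqP ->; exists 0.
rewrite leq_eqVlt => /predU1P[->|]; first by exists k.+1.
move=> /= nk; have /IH[j jk <-] : (n <= record_count x k)%N.
  by rewrite -ltnS (leq_trans nk)// -[leqRHS]addn1 leq_add2l leq_b1.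
by exists j => //; exact: leqW.
Qed.

End records.

Section measurable_index.
Context d (T : measurableType d).

Lemma measurable_set_cst (p : Prop) : measurable [set _ : T | p].
Proof.
have [Hp|Np] := pselect p.
- by rewrite (_ : mkset _ = setT)//; apply/seteqP; split.
- by rewrite (_ : mkset _ = set0)//; apply/seteqP; split.
Qed.

Lemma measurable_fun_random_index d' (T' : measurableType d') (N : T -> nat)
    (f : nat -> T -> T') :
  (forall k, measurable [set t | N t = k]) ->
  (forall k, measurable_fun [set: T] (f k)) ->
  measurable_fun [set: T] (fun t => f (N t) t).
Proof.
move=> mN mf _ A mA; rewrite setTI.
rewrite (_ : _ @^-1` A = \bigcup_k ([set t | N t = k] `&` f k @^-1` A)).
  apply: bigcupT_measurable => k; apply: measurableI => //.
  by rewrite -[X in measurable X]setTI; exact: mf.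
apply/seteqP; split => t /=; first by exists (N t).
by move=> [k _ [/= <-]].
Qed.

Lemma measurable_least_index (p : T -> pred nat) (k j : nat) :
  (forall i, measurable [set t | p t i]) ->
  measurable [set t | least_index (p t) k = j].
Proof.
move=> mp.
rewrite (_ : mkset _ =
    ([set t | p t j] `&` \bigcap_(i in [set i | (i < j)%N]) ~` [set t | p t i])
    `|` ([set _ | j = k] `&` \bigcap_i ~` [set t | p t i])).
  apply: measurableU; apply: measurableI => //.
  - rewrite (_ : \bigcap_(i in _) _ =
        \bigcap_i ([set _ | ~ (i < j)%N] `|` ~` [set t | p t i])).
      apply: bigcapT_measurable => i; apply: measurableU.
        exact: measurable_set_cst.
      exact: measurableC.
    apply/seteqP; split => t H i /=.
      by move=> _; have [ij|ij] := pselect (i < j)%N; [right; exact: H|left].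
    by move=> ij; have [//|] := H i I.
  - exact: measurable_set_cst.
  - by apply: bigcapT_measurable => i; exact: measurableC.
apply/seteqP; split => t /=.
  move/least_indexP => [[pj jp]|[-> np]]; [left|right]; split => // i /=.
  - by move=> /jp /negP.
  - by move=> _; apply/negP; exact: np.
move=> [[pj jp]|[jk np]]; apply/least_indexP; [left|right]; split => // i.
- by move=> ij; apply/negP; exact: jp.
- by apply/negP; exact: np.
Qed.

End measurable_index.

Section measurable_records.
Context {d : Order.disp_t} {S : poTopType d}.
Hypothesis mle : measurable (le_graph S).
Context d' (T : measurableType d') (X : nat -> T -> borel S).

(** Measurability holds on the whole sample space, including the null event where
the recursion stops moving. *)
Lemma measurable_ladder_index n k : (forall i, measurable_fun [set: T] (X i)) ->
  measurable [set t | ladder_index (X ^~ t : nat -> S) n = k].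
Proof.
move=> mX; elim: n k => [|n IH] k /=; first exact: measurable_set_cst.
pose p j t i := (j < i)%N && ((X j t : S) <= X i t)%O.
rewrite (_ : mkset _ = \bigcup_j
   ([set t | ladder_index (X ^~ t : nat -> S) n = j] `&`
    [set t | least_index (p j t) j = k])).
  apply: bigcupT_measurable => j; apply: measurableI => //.
  apply: measurable_least_index => i; rewrite /p.
  case: (j < i)%N => /=; last exact: measurable_set_cst.
  exact: (measurable_le_fun mle).
apply/seteqP; split => t /=; last by move=> [j _ [/= ->]].
by move=> <-; exists (ladder_index (X ^~ t : nat -> S) n).
Qed.

Lemma measurable_ladder n : (forall i, measurable_fun [set: T] (X i)) ->
  measurable_fun [set: T] (ladder X n : T -> borel S).
Proof.
move=> mX; apply: measurable_fun_random_index => // k.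
exact: measurable_ladder_index.
Qed.

Lemma measurable_record_value k :
  (forall i, (i <= k)%N -> measurable_fun [set: T] (X i)) ->
  measurable_fun [set: T] (fun t => record_value (X ^~ t : nat -> S) k : borel S).
Proof.
elim: k => [|k IH] mX; first exact: mX.
rewrite (_ : (fun t => _) = fun t =>
    if ((record_value (X ^~ t : nat -> S) k : S) <= X k.+1 t)%O then X k.+1 t
    else (record_value (X ^~ t : nat -> S) k : borel S)); last first.
  by apply/funext => t; rewrite /record_value/=; case: ifP.
have mV : measurable_fun [set: T]
    (fun t => record_value (X ^~ t : nat -> S) k : borel S).
  by apply: IH => i ik; apply: mX; exact: leqW.
apply: measurable_fun_ifT => //; last exact: mX.
apply: (measurable_fun_bool true); rewrite setTI.
by apply: (measurable_le_fun mle) => //; exact: mX.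
Qed.

Lemma measurable_record_count k :
  (forall i, (i <= k)%N -> measurable_fun [set: T] (X i)) ->
  measurable_fun [set: T] (fun t => record_count (X ^~ t : nat -> S) k).
Proof.
elim: k => [|k IH] mX /=; first exact: measurable_cst.
have mXk i : (i <= k)%N -> measurable_fun [set: T] (X i).
  by move=> ik; apply: mX; exact: leqW.
apply: measurable_fun_addn; first exact: IH.
apply: measurable_fun_ifT; [|exact: measurable_cst..].
apply: (measurable_fun_bool true); rewrite setTI.
by apply: (measurable_le_fun mle); [exact: measurable_record_value|exact: mX].
Qed.

Lemma measurable_record_trace i k :
  (forall i, (i <= k)%N -> measurable_fun [set: T] (X i)) ->
  measurable_fun [set: T] (fun t => record_trace (X ^~ t : nat -> S) i k : borel S).
Proof.
elim: k => [|k IH] mX; first exact: mX.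
rewrite (_ : (fun t => _) = fun t =>
    if (record_count (X ^~ t : nat -> S) k.+1 <= i)%N
    then (record_value (X ^~ t : nat -> S) k.+1 : borel S)
    else (record_trace (X ^~ t : nat -> S) i k : borel S)); last by [].
apply: measurable_fun_ifT.
- by apply: measurable_fun_leq; [exact: measurable_record_count|exact: measurable_cst].
- exact: measurable_record_value.
- by apply: IH => j jk; apply: mX; exact: leqW.
Qed.

End measurable_records.

(** * Independence of the past and the next term *)

Section past.
Local Open Scope ereal_scope.
Context {R : realType} d' (Omega : measurableType d') (P : probability Omega R).
Context d (T : measurableType d) (X : nat -> {RV P >-> T}) (Q : probability T R).
Hypothesis XQ : iid X Q.

(** A pi-system that generates the sigma-algebra of the past up to time [k]. *)
Definition cylinders k : set (set Omega) :=
  [set E | exists2 A : nat -> set T, (forall i, measurable (A i)) &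
    E = \bigcap_(i in `I_k.+1) (X i @^-1` A i)].

Lemma cylinders_measurable k : cylinders k `<=` measurable.
Proof.
move=> _ [A mA ->]; apply: bigcap_measurable => [|i _]; first by exists 0%N.
by rewrite -[X in measurable X]setTI; exact: measurable_funP.
Qed.

Lemma past_measurable k (E : set Omega) : <<s cylinders k >> E -> measurable E.
Proof.
apply: smallest_sub; [exact: sigma_algebra_measurable|].
exact: cylinders_measurable.
Qed.

Lemma measurable_past_term k i : (i <= k)%N ->
  measurable_fun [set: g_sigma_algebraType (cylinders k)] (X i).
Proof.
move=> ik _ A mA; rewrite setTI; apply: sub_sigma_algebra.
exists (fun j => if j == i then A else setT) => [j|]; first by case: ifP.
apply/seteqP; split => [w XA j _ /=|w /(_ i ik)/=]; last by rewrite eqxx.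
by case: eqP => [->|].
Qed.

Lemma probability_cylinder k (A : nat -> set T) :
  (forall i, measurable (A i)) ->
  P (\bigcap_(i in `I_k) (X i @^-1` A i)) = \prod_(i <- iota 0 k) Q (A i).
Proof.
move=> mA; have [ind law] := XQ.
rewrite (_ : \bigcap_(i in `I_k) _ =
  \bigcap_(i in [set` [fset j in iota 0 k]%fset]) (X i @^-1` A i)); last first.
  congr (\bigcap_(i in _) _); apply/seteqP.
  by split => i /=; rewrite inE/= mem_iota.
rewrite ind// (perm_big (iota 0 k))/=; last first.
  apply: uniq_perm; [exact: fset_uniq|exact: iota_uniq|].
  by move=> i; rewrite inE.
by apply: eq_bigr => i _; rewrite -(law i).
Qed.

(** Both sides are finite measures in [E], and they agree on the cylinders by the
product rule. *)
Lemma past_independence k (E : set Omega) (A : set T) :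
  <<s cylinders k >> E -> measurable A ->
  P (E `&` X k.+1 @^-1` A) = P E * Q A.
Proof.
move=> sE mA.
have mXA : measurable (X k.+1 @^-1` A).
  by rewrite -[X in measurable X]setTI; exact: measurable_funP.
have qA0 : (0 <= fine (Q A))%R by exact: fine_ge0.
pose m2 := mscale (NngNum qA0) P.
have m2E B : m2 B = P B * Q A.
  by rewrite /m2 /mscale/= fineK ?fin_num_measure// muleC.
rewrite -m2E.
apply: (@g_sigma_algebra_measure_unique _ _ _ (cylinders k) _ (fun=> setT)
  _ _ (mrestr P mXA) m2) => //.
- exact: cylinders_measurable.
- move=> _; exists (fun=> setT) => //.
  by apply/esym; rewrite -subTset => w _ i.
- by apply/seteqP; split => // w _; exists 0%N.
- move=> _ _ [A1 mA1 ->] [A2 mA2 ->]; exists (fun i => A1 i `&` A2 i).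
    by move=> i; exact: measurableI.
  by rewrite -bigcapI.
- move=> _ [B mB ->]; rewrite [RHS]m2E /= /mrestr.
  pose B' i := if i == k.+1 then A else B i.
  have mB' i : measurable (B' i) by rewrite /B'; case: ifP.
  have B'E i : (i <= k)%N -> B' i = B i.
    by rewrite /B'; case: eqP => // -> /[!ltnn].
  rewrite (_ : _ `&` _ = \bigcap_(i in `I_k.+2) (X i @^-1` B' i)).
    rewrite !probability_cylinder// -addn1 iotaD big_cat/= big_seq1 add0n.
    rewrite {2}/B' eqxx; congr (_ * _).
    rewrite -[0%N :: _]/(iota 0 k.+1) !big_seq; apply: eq_bigr => i.
    rewrite mem_iota => /andP[_ ik].
    by rewrite B'E.
  apply/seteqP; split => w.
    move=> [wB wA] i /=; rewrite ltnS leq_eqVlt => /predU1P[->|ik].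
      by rewrite /B' eqxx.
    by rewrite B'E//; exact: wB.
  move=> wB'; split; last by have := wB' k.+1 (ltnSn _); rewrite /B' eqxx.
  by move=> i /= ik; rewrite -B'E//; apply: wB' => /=; exact: leqW.
- by move=> _; rewrite /= /mrestr setTI (le_lt_trans (probability_le1 _ _))// ltry.
Qed.

(** By independence the joint law of [V] and the next term is the product of their
laws. *)
Lemma expectation_next k d1 (T1 : measurableType d1) (V : Omega -> T1)
    (f : T1 * T -> \bar R) :
  measurable_fun [set: g_sigma_algebraType (cylinders k)] V ->
  measurable_fun [set: T1 * T] f -> (forall p, 0 <= f p) ->
  \int[P]_w f (V w, X k.+1 w) = \int[P]_w \int[Q]_s f (V w, s).
Proof.
move=> pV mf f0.
have mV : measurable_fun [set: Omega] V.
  by move=> _ B mB; apply: (@past_measurable k); exact: pV.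
pose VRV : {RV P >-> T1} := HB.pack V (isMeasurableFun.Build _ _ _ _ V mV).
have mVX := measurable_fun_pair mV (measurable_funP (X k.+1)).
pose VX : {RV P >-> (T1 * T)%type} :=
  HB.pack (fun w => (V w, X k.+1 w)) (isMeasurableFun.Build _ _ _ _ _ mVX).
transitivity (\int[pushforward P (fun w => (V w, X k.+1 w))]_p f p).
  by rewrite (ge0_integral_pushforward mVX P measurableT mf)// preimage_setT.
transitivity (\int[pushforward P V]_v \int[Q]_s f (v, s)); last first.
  rewrite (ge0_integral_pushforward mV P measurableT) ?preimage_setT//.
    exact: measurable_fun_fubini_tonelli_F.
  by move=> v _; exact: integral_ge0.
have -> : \int[pushforward P V]_v \int[Q]_s f (v, s) =
    \int[distribution P VRV \x Q]_p f p by rewrite fubini_tonelli1.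
apply: (eq_measure_integral (distribution P VRV \x Q)
  (m1 := distribution P VX)) => B mB _.
apply/esym; apply: product_measure_unique => // A1 A2 mA1 mA2.
apply: (@past_independence k (V @^-1` A1)) => //.
by rewrite -[X in <<s _ >> X]setTI; exact: pV.
Qed.

End past.

(** * The upper probability function *)

Section upf_theory.
Local Open Scope ereal_scope.
Context {R : realType} {d : Order.disp_t} {S : poTopType d}.
Hypothesis mle : measurable (le_graph S).

Definition upset (x : S) : set (borel S) := [set t : S | (x <= t)%O].

Lemma measurable_upset x : measurable (upset x).
Proof. exact: (measurable_le_fun mle (f := cst (x : borel S))). Qed.

Variable Q : probability (borel S) R.

(** Probabilities are finite, so [fine] can be undone. *)
Lemma upfE x : (upf Q x)%:E = Q (upset x).
Proof.
by rewrite /upf fineK// fin_num_measure//; exact: measurable_upset.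
Qed.

(** [F x] is the [Q]-measure of the section at [x] of the graph of the order. *)
Lemma measurable_upf : measurable_fun [set: borel S] (upf Q).
Proof.
apply/measurable_EFinP; rewrite (_ : _ \o _ = Q \o
    xsection (le_graph S)).
  exact: measurable_fun_xsection.
apply/funext => x; rewrite /= upfE; congr (Q _).
by apply/seteqP; split => t; rewrite /xsection /= inE.
Qed.

End upf_theory.

Section constant_rate_theory.
Local Open Scope ereal_scope.
Context {R : realType} {d : Order.disp_t} {S : poTopType d}.
Context (lam : {measure set (borel S) -> \bar R}) (Q : probability (borel S) R).
Variable alpha : R.
Hypothesis rate : constant_rate lam Q alpha.
Hypothesis F_gt0 : forall x : S, (0 < upf Q x)%R.
Hypothesis mle : measurable (le_graph S).

(** The sets where [F >= 1/(k+1)] cover the space since [F > 0], and each has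
[lam]-measure at most [(k+1) / alpha] since [alpha * F] has integral 1. *)
Lemma constant_rate_sigma_finite : sigma_finite [set: borel S] lam.
Proof.
have [a0 [_ _ QE]] := rate.
pose E (k : nat) : set (borel S) := [set x | (k.+1%:R^-1 <= upf Q x)%R].
have mE k : measurable (E k).
  rewrite -[X in measurable X]setTI.
  rewrite (_ : E k = upf Q @^-1` `[k.+1%:R^-1%R, +oo[%classic).
    by apply: measurable_upf.
  by apply/seteqP; split => x /=; rewrite in_itv/= andbT.
exists E.
  apply/esym; rewrite -subTset => x _.
  have [k kx] := ltr_add_invr (F_gt0 x); rewrite add0r in kx.
  by exists k => //; exact: ltW.
move=> k; split => //.
have c0 : (0 < alpha * k.+1%:R^-1)%R by rewrite mulr_gt0.
have : (alpha * k.+1%:R^-1)%:E * lam (E k) <= 1.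
  rewrite -(integral_cst lam (mE k) (_)%:E).
  apply: (le_trans _ (probability_le1 Q (mE k))); rewrite QE//.
  apply: ge0_le_integral => //.
  - by move=> x _; rewrite lee_fin ltW.
  - apply/measurable_EFinP/measurable_funM => //.
    by apply: measurable_funTS; exact: measurable_upf.
  - by move=> x Ex; rewrite lee_fin ler_pM2l.
by rewrite -lee_pdivlMl// => /le_lt_trans; apply; rewrite mule1 ltry.
Qed.

End constant_rate_theory.

(** * The Markov property of the ladder variables *)

Section ladder_transition.
Local Open Scope ereal_scope.
Context {R : realType} {d : Order.disp_t} {S : poTopType d}.
Hypothesis mle : measurable (le_graph S).
Context d' (Omega : measurableType d') (P : probability Omega R).
Context (X : nat -> {RV P >-> borel S}) (Q : probability (borel S) R).
Hypothesis XQ : iid X Q.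

Local Notation path w := (X ^~ w : nat -> S).
Local Notation Y := (ladder (fun i => X i : Omega -> S) : nat -> Omega -> borel S).
Local Notation F := (upf Q).

Lemma initial_tuple_last n w : tnth (initial_tuple Y n.+1 w) ord_max = Y n w.
Proof. by rewrite tnth_mktuple. Qed.

Lemma initial_tuple_trcons n w :
  initial_tuple Y n.+1 w = trcons (initial_tuple Y n w, Y n w).
Proof.
apply: eq_from_tnth => i; rewrite tnth_mktuple.
have [iln|] := ltnP i n.
  by rewrite (tnth_trcons_lt _ iln) tnth_mktuple.
move=> ni; have -> : i = ord_max.
  by apply/val_inj/eqP => /=; rewrite eqn_leq ni -ltnS ltn_ord.
by rewrite tnth_trcons_last.
Qed.

Lemma measurable_ladder_term n : measurable_fun [set: Omega] (Y n).
Proof. exact: (measurable_ladder mle (X := fun i => X i : Omega -> borel S)). Qed.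

Lemma measurable_initial_tuple n :
  measurable_fun [set: Omega] (initial_tuple Y n).
Proof.
apply/measurable_fun_tnthP => i; rewrite (_ : _ \o _ = Y i).
  exact: measurable_ladder_term.
by apply/funext => w; rewrite /= tnth_mktuple.
Qed.

(** The rank at time [k] is the index of the ladder variable that is current at
that time. *)
Definition current_rank n k : set Omega := [set w | record_count (path w) k = n].

Definition rank_jump n k : set Omega :=
  current_rank n k `&` current_rank n.+1 k.+1.

Definition reached n : set Omega := \bigcup_k current_rank n k.

(** A jump asks the next term to dominate the current ladder value: a condition
on the past and on one independent term. *)
Lemma rank_jumpE n k w : rank_jump n k w <->
  current_rank n k w /\ ((Y n w : S) <= X k.+1 w)%O.
Proof.
rewrite /rank_jump /current_rank /=.
split => -[<-]; rewrite /ladder ladder_index_count.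
  rewrite -/(record_value (path w) k).
  by case: (_ <= _)%O => //=; rewrite addn0 => /n_Sn.
by rewrite -/(record_value (path w) k) => ->; rewrite addn1.
Qed.

Lemma rank_jump_next n k w : rank_jump n k w -> Y n.+1 w = X k.+1 w.
Proof.
move=> jump; have /rank_jumpE[Ck YX] := jump; have [_ Ck1] := jump.
rewrite /ladder -Ck1 ladder_index_count/=.
by move: YX; rewrite /ladder -Ck ladder_index_count => ->.
Qed.

Let mX i : measurable_fun [set: Omega] (X i). Proof. by []. Qed.

Lemma measurable_current_rank n k : measurable (current_rank n k).
Proof.
rewrite -[X in measurable X]setTI.
by apply: (measurable_record_count mle (X := fun i => X i : Omega -> borel S)
  (k := k) _ measurableT (Y := [set n])).
Qed.

Lemma measurable_rank_jump n k : measurable (rank_jump n k).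
Proof. by apply: measurableI; exact: measurable_current_rank. Qed.

Lemma measurable_reached n : measurable (reached n).
Proof. by apply: bigcupT_measurable => k; exact: measurable_current_rank. Qed.

Lemma bigcup_rank_jump n : \bigcup_k rank_jump n k = reached n.+1.
Proof.
apply/seteqP; split => w [k _]; first by case=> _; exists k.+1.
rewrite /current_rank/=; elim: k => //= k IH.
case: (boolP (_ <= _)%O) => [le|_]; last by rewrite addn0.
rewrite addn1 => -[kn]; exists k => //; split; rewrite /current_rank//=.
by rewrite le addn1 kn.
Qed.

(** The rank never decreases, so a given rank is left at most once. *)
Lemma trivIset_rank_jump n : trivIset setT (rank_jump n).
Proof.
have lt k l w : (k < l)%N -> rank_jump n k w -> rank_jump n l w -> False.
  move=> kl [_ Ck] [Cl _]; have := record_count_homo (path w) kl.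
  by rewrite [X in (X <= _)%N]Ck [X in (_ <= X)%N]Cl ltnn.
move=> k l _ _ [w [wk wl]]; case: (ltngtP k l) => // kl; exfalso.
  exact: lt kl wk wl.
exact: lt kl wl wk.
Qed.

(** On [current_rank n k] the ladder variables up to index [n] are functions of
the terms up to time [k], and the jump happens when the next term, which is
independent of these, falls in [upset (Y n w)]. *)
Lemma ladder_step n k (f : n.+1.-tuple (borel S) * borel S -> \bar R) :
  measurable_fun setT f -> (forall p, 0 <= f p) ->
  \int[P]_(w in rank_jump n k) f (initial_tuple Y n.+1 w, Y n.+1 w) =
  \int[P]_(w in current_rank n k)
    \int[Q]_(s in upset (Y n w)) f (initial_tuple Y n.+1 w, s).
Proof.
move=> mf f0.
(* The rank and the traces are past-measurable on the whole sample space, whereas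
   the ladder variables are known at time k only where the rank is n. *)
pose V w : nat * n.+1.-tuple (borel S) := (record_count (path w) k,
  [tuple record_trace (path w) i k : borel S | i < n.+1]).
have pV : measurable_fun [set: g_sigma_algebraType (cylinders X k)] V.
  have pX i : (i <= k)%N ->
      measurable_fun [set: g_sigma_algebraType (cylinders X k)] (X i).
    exact: measurable_past_term.
  apply: measurable_fun_pair; first exact: measurable_record_count.
  apply/measurable_fun_tnthP => i.
  rewrite (_ : _ \o _ = fun w => record_trace (path w) i k : borel S).
    exact: measurable_record_trace.
  by apply/funext => w; rewrite /= tnth_mktuple.
have VE w : current_rank n k w -> V w = (n, initial_tuple Y n.+1 w).
  rewrite /V => Cw; congr pair => //; apply: eq_from_tnth => i.
  by rewrite !tnth_mktuple record_traceE// Cw -ltnS.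
pose A := [set p : nat * n.+1.-tuple (borel S) * borel S |
  p.1.1 = n /\ ((tnth p.1.2 ord_max : S) <= p.2)%O].
have mA : measurable A.
  apply: measurableI.
    rewrite -[X in measurable X]setTI.
    by apply: (measurableT_comp measurable_fst measurable_fst measurableT
                 (Y := [set n])).
  apply: (measurable_le_fun mle) => //.
  apply: (measurableT_comp (measurable_tnth ord_max)).
  exact: (measurableT_comp measurable_snd measurable_fst).
pose g (p : nat * n.+1.-tuple (borel S) * borel S) : \bar R :=
  (\1_A p)%:E * f (p.1.2, p.2).
have mg : measurable_fun setT g.
  apply: emeasurable_funM; first exact/measurable_EFinP.
  apply: (measurableT_comp mf); apply: measurable_fun_pair => //.
  exact: (measurableT_comp measurable_snd measurable_fst).
have g0 p : 0 <= g p by rewrite mule_ge0.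
transitivity (\int[P]_w g (V w, X k.+1 w)).
  rewrite integral_mkcond; apply: eq_integral => w _.
  rewrite patchE; case: ifPn => [/set_mem jump|/negP njump].
    have [Cw _] := jump; rewrite VE// (rank_jump_next jump) /g/=.
    rewrite indicE mem_set ?mul1e//; split=> //=.
    by rewrite initial_tuple_last; have /rank_jumpE[] := jump.
  rewrite /g indicE memNset ?mul0e// => -[Cw YX]; apply/njump/mem_set/rank_jumpE.
  split=> //; rewrite -initial_tuple_last.
  by rewrite -[initial_tuple Y n.+1 w]/((n, initial_tuple Y n.+1 w).2) -VE.
rewrite (expectation_next XQ pV mg g0) [RHS]integral_mkcond.
apply: eq_integral => w _; rewrite patchE.
case: ifPn => [/set_mem Cw|/negP nC].
  rewrite [RHS]integral_mkcond; apply: eq_integral => s _.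
  rewrite VE// /g/= patchE indicE.
  have -> : ((n, initial_tuple Y n.+1 w, s) \in A) = (s \in upset (Y n w)).
    apply/idP/idP => /set_mem.
      by case=> _ /=; rewrite initial_tuple_last => ?; exact: mem_set.
    by move=> ?; apply: mem_set; split => //=; rewrite initial_tuple_last.
  by case: ifPn; rewrite ?mul1e ?mul0e.
apply: integral0_eq => s _; rewrite /g indicE memNset ?mul0e//.
by move=> [/= Cw _]; exact/nC/mem_set.
Qed.

Hypothesis F_gt0 : forall x : S, (0 < F x)%R.

Let mF : measurable_fun [set: borel S] F. Proof. exact: measurable_upf. Qed.

(** Rank [n+1] is reached by exactly one jump. *)
Lemma ladder_sum_steps n (f : n.+1.-tuple (borel S) * borel S -> \bar R) :
  measurable_fun setT f -> (forall p, 0 <= f p) ->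
  \int[P]_(w in reached n.+1) f (initial_tuple Y n.+1 w, Y n.+1 w) =
  \sum_(k <oo) \int[P]_(w in current_rank n k)
    \int[Q]_(s in upset (Y n w)) f (initial_tuple Y n.+1 w, s).
Proof.
move=> mf f0; rewrite -bigcup_rank_jump ge0_integral_bigcup//.
- by apply: eq_eseriesr => k _; exact: ladder_step.
- exact: measurable_rank_jump.
- apply: measurable_funTS; apply: (measurableT_comp mf).
  apply: measurable_fun_pair; first exact: measurable_initial_tuple.
  exact: measurable_ladder_term.
- exact: trivIset_rank_jump.
Qed.

(** The case where [f] ignores the new term: its integral over [upset (Y n w)] is
then constant, with factor [F (Y n w)]. *)
Lemma ladder_sum_sojourns n (h : n.+1.-tuple (borel S) -> \bar R) :
  measurable_fun setT h -> (forall p, 0 <= h p) ->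
  \int[P]_(w in reached n.+1) h (initial_tuple Y n.+1 w) =
  \sum_(k <oo) \int[P]_(w in current_rank n k)
    (h (initial_tuple Y n.+1 w) * (F (Y n w))%:E).
Proof.
move=> mh h0; rewrite (ladder_sum_steps (f := h \o fst))//; last 2 first.
- exact: measurableT_comp.
- by move=> p; exact: h0.
apply: eq_eseriesr => k _; apply: eq_integral => w _ /=.
rewrite (integral_cst Q _ (h (initial_tuple Y n.+1 w))) ?upfE//.
exact: measurable_upset.
Qed.

Let mFY n : measurable_fun [set: Omega] (fun w => (F (Y n w))%:E).
Proof.
by apply/measurable_EFinP; apply: measurableT_comp => //; exact: measurable_ladder_term.
Qed.

Lemma probability_rank_jump n k :
  P (rank_jump n k) = \int[P]_(w in current_rank n k) (F (Y n w))%:E.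
Proof.
have mJ := measurable_rank_jump n k.
have := @ladder_step n k (cst 1) (measurable_cst _) (fun=> lee01).
rewrite integral_cst// mul1e => ->; apply: eq_integral => w _.
by rewrite (integral_cst Q _ 1) ?mul1e ?upfE//; exact: measurable_upset.
Qed.

(** A path that reaches rank [n] but not [n+1] is stuck at rank [n] from some time
[l] on.  On that event the integral of [F (Y n)] is bounded by the probability of
a jump at time [k], for every [k >= l].  These probabilities have a finite sum,
so the integral vanishes; as [F > 0], the event is null. *)
Lemma negligible_not_reached n : P.-negligible (~` reached n).
Proof.
elim: n => [|n IH].
  rewrite (_ : reached 0%N = setT) ?setCT; first exact: negligible_set0.
  by apply/seteqP; split => // w _; exists 0%N.
pose stuck l := \bigcap_(k in [set k | (l <= k)%N]) current_rank n k.
have stuckE : ~` reached n.+1 `<=` ~` reached n `|` \bigcup_l stuck l.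
  move=> w nr; have [[l _ Cl]|] := pselect (reached n w); [right|by left].
  exists l => // k /= lk.
  apply/eqP; rewrite eqn_leq -{2}Cl record_count_homo// andbT.
  rewrite leqNgt; apply/negP => /record_count_hits[j _ Cj]; apply: nr.
  by exists j.
apply: (negligibleS stuckE); apply: negligibleU => //.
apply: negligible_bigcup => l.
have mstuck : measurable (stuck l).
  apply: bigcap_measurable => [|k _]; first by exists l => /=.
  exact: measurable_current_rank.
have F0 w : 0 <= (F (Y n w))%:E by rewrite lee_fin ltW.
have stuck_le k : (l <= k)%N ->
    \int[P]_(w in stuck l) (F (Y n w))%:E <= P (rank_jump n k).
  move=> lk; rewrite probability_rank_jump; apply: ge0_subset_integral => //.
  - exact: measurable_current_rank.
  - exact: measurable_funTS.
  - by move=> w; exact.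
have jump_tail : \sum_(N <= k <oo) P (rank_jump n k) @[N --> \oo] --> 0.
  apply: nneseries_tail_cvg => //.
  rewrite -measure_semi_bigcup//; last 3 first.
  - exact: measurable_rank_jump.
  - exact: trivIset_rank_jump.
  - by apply: bigcupT_measurable; exact: measurable_rank_jump.
  rewrite (le_lt_trans (probability_le1 _ _)) ?ltry//.
  by apply: bigcupT_measurable; exact: measurable_rank_jump.
have int0 : \int[P]_(w in stuck l) (F (Y n w))%:E = 0.
  apply/eqP; rewrite eq_le integral_ge0// andbT.
  apply: cvge_ge jump_tail; near=> N.
  rewrite (le_trans (stuck_le N _))//; first by near: N; exact: nbhs_infty_ge.
  have := @nneseries_lim_ge R (fun k => P (rank_jump n k)) xpredT N N.+1.
  by rewrite big_nat1; apply.
have : ae_eq P (stuck l) (fun w => (F (Y n w))%:E) (cst 0).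
  apply/ae_eq_integral_abs => //; first exact: measurable_funTS.
  by rewrite -[RHS]int0; apply: eq_integral => w _; rewrite gee0_abs.
apply: negligibleS => w sw /= /(_ sw) [] Fw0.
by have := F_gt0 (Y n w); rewrite Fw0 ltxx.
Unshelve. all: by end_near. Qed.

Lemma integral_reached n (g : Omega -> \bar R) :
  measurable_fun setT g -> (forall w, 0 <= g w) ->
  \int[P]_w g w = \int[P]_(w in reached n) g w.
Proof.
move=> mg g0.
have mNr : measurable (~` reached n).
  by apply: measurableC; exact: measurable_reached.
rewrite (ge0_negligible_integral mNr)// ?setTD ?setCK//.
by apply/negligibleP => //; exact: negligible_not_reached.
Qed.

(** The average of [f (t, _)] under the law [Q] conditioned on lying above the
last entry of [t]. *)
Definition transition_average n
    (f : n.+1.-tuple (borel S) * borel S -> \bar R) (t : n.+1.-tuple (borel S)) :=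
  ((F (tnth t ord_max))^-1)%:E *
  \int[Q]_(s in upset (tnth t ord_max)) f (t, s).

Lemma transition_average_ge0 n (f : n.+1.-tuple (borel S) * borel S -> \bar R) t :
  (forall p, 0 <= f p) -> 0 <= transition_average f t.
Proof.
by move=> f0; rewrite mule_ge0 ?integral_ge0// lee_fin invr_ge0 ltW.
Qed.

Lemma measurable_transition_average n
    (f : n.+1.-tuple (borel S) * borel S -> \bar R) :
  measurable_fun setT f -> (forall p, 0 <= f p) ->
  measurable_fun setT (transition_average f).
Proof.
move=> mf f0.
pose A := [set p : n.+1.-tuple (borel S) * borel S |
  ((tnth p.1 ord_max : S) <= p.2)%O].
have mA : measurable A.
  apply: (measurable_le_fun mle) => //.
  exact: (measurableT_comp (measurable_tnth ord_max) measurable_fst).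
apply: emeasurable_funM.
  apply/measurable_EFinP; apply: measurable_fun_inv_ge0 => [|t]; last exact: ltW.
  by apply: (measurableT_comp mF); exact: measurable_tnth.
rewrite (_ : (fun t => _) = fubini_F Q (f \_ A)).
  apply: measurable_fun_fubini_tonelli_F.
    exact/(measurable_restrictT _ mA)/measurable_funTS.
  by move=> p; rewrite patchE; case: ifP.
apply/funext => t; rewrite /fubini_F [LHS]integral_mkcond.
by apply: eq_integral => s _; rewrite !patchE; congr (if _ then _ else _);
   apply/idP/idP => /set_mem As; exact: mem_set.
Qed.

(** Both sides are sums over the times [k] of integrals over [current_rank n k]:
the left one by [ladder_sum_steps], the right one by [ladder_sum_sojourns], whose
factor [F (Y n)] cancels the denominator of the average. *)
Lemma ladder_transition n (f : n.+1.-tuple (borel S) * borel S -> \bar R) :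
  measurable_fun setT f -> (forall p, 0 <= f p) ->
  \int[P]_w f (initial_tuple Y n.+1 w, Y n.+1 w) =
  \int[P]_w transition_average f (initial_tuple Y n.+1 w).
Proof.
move=> mf f0.
have mYY := @measurable_initial_tuple n.+1.
have mh := measurable_transition_average mf f0.
have h0 t := transition_average_ge0 t f0.
rewrite (@integral_reached n.+1)//; last first.
  by apply: (measurableT_comp mf); apply: measurable_fun_pair => //;
     exact: measurable_ladder_term.
rewrite [RHS](@integral_reached n.+1)//; last exact: measurableT_comp.
rewrite (ladder_sum_steps mf f0) (ladder_sum_sojourns mh h0).
apply: eq_eseriesr => k _; apply: eq_integral => w _.
rewrite /transition_average initial_tuple_last muleAC -EFinM mulVf ?mul1e//.
exact: lt0r_neq0.
Qed.

End ladder_transition.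

(** * Joint and marginal densities under a constant rate *)

Section ladder_laws.
Local Open Scope ereal_scope.
Context {R : realType} {d : Order.disp_t} {S : poTopType d}.
Hypothesis mle : measurable (le_graph S).
Context d' (Omega : measurableType d') (P : probability Omega R).
Context (X : nat -> {RV P >-> borel S}) (Q : probability (borel S) R).
Hypothesis XQ : iid X Q.
Hypothesis F_gt0 : forall x : S, (0 < upf Q x)%R.
Context (lam : {sigma_finite_measure set (borel S) -> \bar R}) (alpha : R).
Hypothesis alpha_gt0 : (0 < alpha)%R.
Hypothesis rate : is_pdf lam Q (fun x => (alpha * upf Q x)%:E).

Local Notation Y := (ladder (fun i => X i : Omega -> S) : nat -> Omega -> borel S).
Local Notation F := (upf Q).

Let mF : measurable_fun [set: borel S] F. Proof. exact: measurable_upf. Qed.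
Let F0 x : (0 <= F x)%R. Proof. exact: ltW. Qed.

Let mYt n : measurable_fun [set: Omega] (initial_tuple Y n).
Proof. exact: measurable_initial_tuple. Qed.

Definition ladder_density n : n.+1.-tuple (borel S) -> \bar R :=
  density_on (chain n.+1) (fun t => (alpha ^+ n.+1 * F (tnth t ord_max))%:E).

(** With an indicator in place of a case distinction, measurability and positivity
are read off a product. *)
Lemma ladder_densityE n t :
  @ladder_density n t =
  (\1_(chain n.+1) t * (alpha ^+ n.+1 * F (tnth t ord_max)))%:E.
Proof.
rewrite /ladder_density /density_on patchE indicE.
by case: ifP; rewrite ?mul1r ?mul0r.
Qed.

Lemma ladder_density_ge0 n t : 0 <= @ladder_density n t.
Proof. by rewrite ladder_densityE lee_fin !mulr_ge0 ?exprn_ge0// ltW. Qed.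

Lemma measurable_ladder_density n : measurable_fun setT (@ladder_density n).
Proof.
rewrite (funext (@ladder_densityE n)); apply/measurable_EFinP.
apply: measurable_funM; first by apply: measurable_indic; exact: measurable_chain.
apply: measurable_funM => //.
by apply: (measurableT_comp mF); exact: measurable_tnth.
Qed.

Lemma integral_rate (f : borel S -> \bar R) (A : set (borel S)) :
  measurable A -> measurable_fun setT f -> (forall x, 0 <= f x) ->
  \int[Q]_(x in A) f x = \int[lam]_(x in A) (f x * (alpha * F x)%:E).
Proof.
move=> mA mf f0; rewrite integral_mkcond.
rewrite (integral_pdf (V := id) _ rate)//.
- rewrite [RHS]integral_mkcond; apply: eq_integral => x _; rewrite !patchE.
  by case: ifP => //; rewrite mul0e.
- exact/(measurable_restrictT _ mA)/measurable_funTS.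
- by move=> x; rewrite patchE; case: ifP.
Qed.

(** The telescoping: the factor [F] of the last entry of [t] in the density cancels
the denominator of the average, and [alpha * F s] comes from the density of [Q]. *)
Lemma transition_average_density n (f : n.+1.-tuple (borel S) * borel S -> \bar R)
    (t : n.+1.-tuple (borel S)) :
  measurable_fun setT f -> (forall p, 0 <= f p) ->
  transition_average Q f t * ladder_density t =
  \int[lam]_s (f (t, s) * ladder_density (trcons (t, s))).
Proof.
move=> mf f0; rewrite /transition_average integral_rate//; last 2 first.
- exact: measurable_upset.
- exact: measurableT_comp.
rewrite ladder_densityE integral_mkcond.
rewrite -muleA [X in _ * X]muleC muleA -EFinM -ge0_integralZl//; last 3 first.
- apply/(measurable_restrictT _ (measurable_upset mle _))/measurable_funTS.
  apply: emeasurable_funM; first exact: measurableT_comp.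
  by apply/measurable_EFinP/measurable_funM.
- move=> s _; rewrite patchE; case: ifP => // _.
  by rewrite mule_ge0// lee_fin mulr_ge0// ltW.
- by rewrite lee_fin !mulr_ge0 ?invr_ge0 ?exprn_ge0// ltW.
apply: eq_integral => s _; rewrite ladder_densityE tnth_trcons_last patchE.
rewrite !indicE.
have -> : (trcons (t, s) \in chain n.+2) =
    (t \in chain n.+1) && (s \in upset (tnth t ord_max)).
  apply/idP/andP => [/set_mem/chain_trcons[ct ts]|[/set_mem ct /set_mem ts]].
    by split; exact: mem_set.
  by apply/mem_set/chain_trcons.
have := F_gt0 (tnth t ord_max).
case: (s \in _); last by rewrite andbF !mul0r !mule0.
case: (t \in _) => /= [Ft|_]; last by rewrite !(mul0r, mulr0) mul0e mule0.
rewrite !mul1r muleC -muleA -EFinM; congr (_ * _%:E).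
by rewrite [X in (_ * X)%R]mulrCA mulVf ?gt_eqF// mulr1 mulrAC [in RHS]exprS.
Qed.

Let mgA n A : measurable A ->
  measurable_fun [set: n.+1.-tuple (borel S)] (@ladder_density n \_ A).
Proof.
move=> mA; apply/(measurable_restrictT _ mA); apply: measurable_funTS.
exact: measurable_ladder_density.
Qed.

Let gA0 n A t : 0 <= (@ladder_density n \_ A) t.
Proof. by rewrite patchE; case: ifP => // _; exact: ladder_density_ge0. Qed.

Lemma ladder_density_fin_num n t : @ladder_density n t \is a fin_num.
Proof. by rewrite ladder_densityE. Qed.

(** By induction on [n]; the step integrates the density of the first ladder
variables against one transition. *)
Lemma initial_tuple_pdf n :
  is_pdf (power_measure lam n.+1) (pushforward P (initial_tuple Y n.+1))
    (@ladder_density n).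
Proof.
split; [exact: measurable_ladder_density|exact: ladder_density_ge0|].
elim: n => [|n IH] A mA.
  pose e (x : borel S) : 1.-tuple (borel S) := trcons ([tuple], x).
  have me : measurable_fun [set: borel S] e.
    by apply: measurableT_comp; [exact: measurable_trcons|exact: measurable_fun_pair].
  have meA : measurable (e @^-1` A) by rewrite -[X in measurable X]setTI; exact: me.
  rewrite integral_mkcond integral_power1; [|exact: mgA|exact: gA0].
  transitivity (Q (e @^-1` A)).
    rewrite -(XQ.2 0%N)//; congr (P _); apply/seteqP; split => w /=;
      by rewrite initial_tuple_trcons (tuple0 (initial_tuple _ 0 w)).
  have [_ _ ->//] := rate; rewrite integral_mkcond; apply: eq_integral => x _.
  have c1 : (trcons ([tuple], x : borel S) : 1.-tuple (borel S)) \in chain 1.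
    exact: mem_set.
  rewrite !patchE ladder_densityE tnth_trcons_last expr1 indicE c1 mul1r.
  by congr (if _ then _ else _); apply/idP/idP => /set_mem xA; exact: mem_set.
have pn : is_pdf (power_measure lam n.+1) (pushforward P (initial_tuple Y n.+1))
    (@ladder_density n).
  by split; [exact: measurable_ladder_density|exact: ladder_density_ge0|].
pose f (p : n.+1.-tuple (borel S) * borel S) : \bar R := (\1_A (trcons p))%:E.
have mf : measurable_fun setT f.
  apply/measurable_EFinP; apply: measurableT_comp; first exact: measurable_indic.
  exact: measurable_trcons.
have f0 p : 0 <= f p by rewrite lee_fin.
transitivity (\int[P]_w f (initial_tuple Y n.+1 w, Y n.+1 w)).
  rewrite /pushforward -[X in P X = _]setIT -integral_indic//.
    by apply: eq_integral => w _; rewrite /f -initial_tuple_trcons.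
  by rewrite -[X in measurable X]setTI; exact: mYt.
rewrite (ladder_transition mle XQ F_gt0 mf f0).
rewrite (integral_pdf (@mYt n.+1) pn)//; last 3 first.
- exact: ladder_density_fin_num.
- exact: measurable_transition_average.
- by move=> t; exact: transition_average_ge0.
rewrite [RHS]integral_mkcond [RHS]integral_power_rcons; [|exact: mgA|exact: gA0].
apply: eq_integral => t _; rewrite transition_average_density//.
apply: eq_integral => s _; rewrite patchE /f indicE.
by case: (_ \in A); rewrite ?mul1e// mul0e.
Qed.

(** The joint density depends on the last entry [s] only and lives on the chains,
so integrating the first [n] entries over [A] leaves the measure of the chains
below [s] that lie in [A].  This gives the law of [Y n] for [A] the full set, and
the conditional law of the past for general [A]. *)
Lemma ladder_joint n (A : set (n.-tuple (borel S))) (B : set (borel S)) :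
  measurable A -> measurable B ->
  P (initial_tuple Y n @^-1` A `&` Y n @^-1` B) =
  \int[lam]_(s in B) ((alpha ^+ n.+1 * F s)%:E *
    power_measure lam n (A `&` chain_below n s)).
Proof.
move=> mA mB.
pose front (t : n.+1.-tuple (borel S)) : n.-tuple (borel S) :=
  [tuple tnth t (widen_ord (leqnSn n) i) | i < n].
have frontE p : front (trcons p) = p.1.
  apply: eq_from_tnth => i; rewrite tnth_mktuple.
  have lin : (widen_ord (leqnSn n) i < n)%N by rewrite /=.
  by rewrite (tnth_trcons_lt _ lin); congr tnth; exact: val_inj.
pose C := front @^-1` A `&` (fun t => tnth t ord_max) @^-1` B.
have mC : measurable C.
  have mfront : measurable_fun [set: n.+1.-tuple (borel S)] front.
    apply/measurable_fun_tnthP => i.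
    rewrite (_ : _ \o _ = fun t => tnth t (widen_ord (leqnSn n) i)).
      exact: measurable_tnth.
    by apply/funext => t; rewrite /= tnth_mktuple.
  apply: measurableI; rewrite -[X in measurable X]setTI; first exact: mfront.
  exact: measurable_tnth.
have [_ _ /(_ C mC) PC] := initial_tuple_pdf n.
transitivity (\int[power_measure lam n.+1]_(t in C) ladder_density t).
  rewrite -PC; congr (P _); apply/seteqP.
  by split => w; rewrite /C/= initial_tuple_trcons frontE tnth_trcons_last.
rewrite integral_mkcond integral_power_rcons; [|exact: mgA|exact: gA0].
rewrite (fubini_tonelli (fun p => (@ladder_density n \_ C) (trcons p)));
  last 2 first.
- by apply: (measurableT_comp (mgA mC)); exact: measurable_trcons.
- by move=> p; exact: gA0.
rewrite [RHS]integral_mkcond; apply: eq_integral => s _; rewrite patchE.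
case: ifPn => [/set_mem Bs|/negP nBs]; last first.
  apply: integral0_eq => t _; rewrite patchE; case: ifPn => // /set_mem [_ /=].
  by rewrite tnth_trcons_last => /mem_set.
have mAC : measurable (A `&` chain_below n s).
  by apply: measurableI => //; exact: measurable_chain_below.
rewrite -(setIT (A `&` _)) -integral_indic// -ge0_integralZl//; last 2 first.
- exact/measurable_EFinP/measurable_indic.
- by rewrite lee_fin mulr_ge0// exprn_ge0// ltW.
apply: eq_integral => t _; rewrite patchE ladder_densityE tnth_trcons_last.
rewrite !indicE [t \in _ `&` _]in_setI.
have -> : (trcons (t, s) \in C) = (t \in A).
  apply/idP/idP => /set_mem.
    by case; rewrite /= frontE => /mem_set.
  by move=> At; apply: mem_set; split; rewrite /= ?frontE// tnth_trcons_last.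
have -> : (trcons (t, s) \in chain n.+1) = (t \in chain_below n s).
  by apply/idP/idP => /set_mem ts; exact: mem_set.
by case: (t \in A); case: (t \in _); rewrite ?(mul1r, mul0r, mule1, mule0).
Qed.

Lemma measurable_cumulative n : measurable_fun [set: borel S]
  (fun s => power_measure lam n (chain_below n (s : S))).
Proof.
rewrite (_ : (fun s => _) = power_measure lam n \o xsection (chain_below_graph n)).
  by apply: measurable_fun_xsection; exact: measurable_chain_below_graph.
by apply/funext => s; rewrite /= xsection_chain_below.
Qed.

Lemma ladder_pdf n :
  is_pdf lam (pushforward P (Y n))
    (fun s => (alpha ^+ n.+1)%:E * power_measure lam n (chain_below n s) * (F s)%:E).
Proof.
split.
- apply: emeasurable_funM; last exact/measurable_EFinP.
  by apply: emeasurable_funM => //; exact: measurable_cumulative.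
- by move=> s; rewrite !mule_ge0// lee_fin// exprn_ge0// ltW.
move=> B mB; have := @ladder_joint n setT B measurableT mB.
rewrite preimage_setT setTI /pushforward => ->; apply: eq_integral => s _.
by rewrite setTI EFinM muleAC.
Qed.

End ladder_laws.

(** * Transition kernel and conditional law of the past *)

Section ladder_chain.
Local Open Scope ereal_scope.
Context {R : realType} {d : Order.disp_t} {S : poTopType d}.
Hypothesis mle : measurable (le_graph S).
Context d' (Omega : measurableType d') (P : probability Omega R).
Context (X : nat -> {RV P >-> borel S}) (Q : probability (borel S) R).
Hypothesis XQ : iid X Q.
Hypothesis F_gt0 : forall x : S, (0 < upf Q x)%R.

Local Notation Y := (ladder (fun i => X i : Omega -> S) : nat -> Omega -> borel S).
Local Notation F := (upf Q).

Lemma xsection_order (y : borel S) :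
  xsection (le_graph S) y = upset (y : S).
Proof. by apply/seteqP; split => t; rewrite /xsection/= inE. Qed.

(** The law [Q] conditioned on lying above [y]. *)
Definition ladder_kernel : R.-pker (borel S) ~> (borel S) :=
  conditioning_kernel Q mle Q.

Let Qupset y : 0 < Q (xsection (le_graph S) y) < +oo.
Proof.
rewrite xsection_order -(upfE mle) lte_fin F_gt0/= ltry//.
Qed.

Lemma ladder_kernelE (y : borel S) A :
  ladder_kernel y A = ((F y)^-1)%:E * Q (A `&` upset y).
Proof.
rewrite /ladder_kernel conditioning_kernelE; last exact: Qupset.
by rewrite xsection_order.
Qed.

Lemma ladder_kernel_pdf (lam : {measure set (borel S) -> \bar R}) alpha (y : S) :
  constant_rate lam Q alpha ->
  is_pdf lam (ladder_kernel y)
    (density_on [set z : S | (y <= z)%O] (fun z => (alpha * (F z / F y))%:E)).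
Proof.
move=> [a0 [mf f0 QE]].
have mF := measurable_upf mle Q.
have mU := measurable_upset mle y.
have d0 z : 0 <= (alpha * (F z / F y))%:E.
  by rewrite lee_fin mulr_ge0 ?divr_ge0// ltW.
have md : measurable_fun setT (fun z : borel S => (alpha * (F z / F y))%:E).
  apply/measurable_EFinP/measurable_funM => //.
  exact: measurable_funM.
split.
- by apply/(measurable_restrictT _ mU); exact: measurable_funTS.
- by move=> z; rewrite /density_on patchE; case: ifP.
move=> A mA; rewrite ladder_kernelE QE; last exact: measurableI.
rewrite -ge0_integralZl//; last 3 first.
- exact: measurableI.
- exact: measurable_funTS.
- by rewrite lee_fin invr_ge0 ltW.
rewrite [LHS]integral_mkcondr; apply: eq_integral => z _.
rewrite /density_on !patchE; case: ifP => // _.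
by rewrite -EFinM mulrCA [(_^-1 * _)%R]mulrC.
Qed.

Lemma ladder_markov : homogeneous_markov_chain P Y ladder_kernel.
Proof.
move=> n.
have mYt : measurable_fun [set: Omega] (initial_tuple Y n.+1).
  exact: measurable_initial_tuple.
have mlast : measurable_fun [set: n.+1.-tuple (borel S)]
    (fun t => tnth t ord_max).
  exact: measurable_tnth.
split; [exact: measurable_ladder_term|exact: mYt| |].
  move=> A mA; exact: (measurableT_comp (measurable_kernel ladder_kernel A mA) mlast).
move=> A B mA mB.
pose f (p : n.+1.-tuple (borel S) * borel S) : \bar R :=
  (\1_B p.1)%:E * (\1_A p.2)%:E.
have mf : measurable_fun setT f.
  apply: emeasurable_funM; apply/measurable_EFinP; apply: measurableT_comp => //;
    exact: measurable_indic.
have f0 p : 0 <= f p by rewrite mule_ge0// lee_fin.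
transitivity (\int[P]_w f (initial_tuple Y n.+1 w, Y n.+1 w)).
  rewrite -[X in P X = _]setIT -integral_indic//; last first.
    apply: measurableI; rewrite -[X in measurable X]setTI; last exact: mYt.
    exact: measurable_ladder_term.
  by apply: eq_integral => w _; rewrite /f/= -EFinM indicI/= mulrC.
rewrite (ladder_transition mle XQ F_gt0 mf f0) [RHS]integral_mkcond.
rewrite (ge0_integral_pushforward mYt P measurableT) ?preimage_setT; last 2 first.
- apply/(measurable_restrictT _ mB); apply: measurable_funTS.
  exact: (measurableT_comp (measurable_kernel ladder_kernel A mA) mlast).
- by move=> t _; rewrite patchE; case: ifP.
apply: eq_integral => w _; rewrite /transition_average /= patchE ladder_kernelE.
rewrite /f/= indicE; case: (_ \in B).
  rewrite -integral_indic//; last exact: measurable_upset.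
  by congr (_ * _); apply: eq_integral => s _; rewrite mul1e.
by rewrite integral0_eq ?mule0// => s _; rewrite mul0e.
Qed.

Context (lam : {sigma_finite_measure set (borel S) -> \bar R}) (alpha : R).
Hypothesis alpha_gt0 : (0 < alpha)%R.
Hypothesis rate : is_pdf lam Q (fun x => (alpha * F x)%:E).
Hypothesis lam_down : forall x : S, lam [set t : S | (t <= x)%O] < +oo.
Variable n : nat.

Local Notation cumul := (fun y : S => power_measure lam n (chain_below n y)).

Lemma cumulative_fin_num y : cumul y \is a fin_num.
Proof. by rewrite ge0_fin_numE//; exact: cumulative_lty. Qed.

(** The density of [Y n] has the cumulative function as a factor. *)
Lemma cumulative_gt0_ae : {ae pushforward P (Y n), forall y : S, 0 < cumul y}.
Proof.
have mc := measurable_cumulative mle lam n.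
exists [set y : borel S | cumul y = 0]; split.
- by rewrite -[X in measurable X]setTI; apply: (mc measurableT [set 0]).
- have [_ _ ->] := ladder_pdf mle XQ F_gt0 alpha_gt0 rate n.
    by apply: integral0_eq => y /= ->; rewrite mule0 mul0e.
  by rewrite -[X in measurable X]setTI; apply: (mc measurableT [set 0]).
- move=> y /= /negP; rewrite -leNgt => c0.
  by apply/eqP; rewrite eq_le c0/= measure_ge0.
Qed.

(** The uniform law on the chains below [y] where their measure is positive, and
an arbitrary point mass elsewhere. *)
Definition past_kernel : R.-pker (borel S) ~> n.-tuple (borel S) :=
  conditioning_kernel (power_measure lam n)
    (measurable_chain_below_graph mle (n := n))
    (dirac [tuple of nseq n point]).

Lemma past_kernelE (y : S) A : 0 < cumul y ->
  past_kernel y A =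
  ((fine (cumul y))^-1)%:E * power_measure lam n (A `&` chain_below n y).
Proof.
move=> c0; rewrite /past_kernel conditioning_kernelE xsection_chain_below//.
by rewrite c0; exact: cumulative_lty.
Qed.

Lemma past_kernel_pdf (y : S) : 0 < cumul y ->
  is_pdf (power_measure lam n) (past_kernel y)
    (density_on (chain_below n y) (fun=> ((fine (cumul y))^-1)%:E)).
Proof.
move=> c0; have c_oo := @cumulative_lty _ _ _ mle lam lam_down n y.
have := @conditioning_kernel_pdf _ _ _ _ _ (power_measure lam n) _
  (measurable_chain_below_graph mle (n := n)) (dirac [tuple of nseq n point]) y.
by rewrite xsection_chain_below; apply; rewrite c0.
Qed.

(** Multiplying the uniform law by the density of [Y n] cancels the normalisation
and gives the density found in [ladder_joint].  Where the cumulative function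
vanishes both sides are zero. *)
Lemma past_kernel_cond : cond_distribution P (initial_tuple Y n) (Y n)
  (fun y A => past_kernel y A).
Proof.
have mY : measurable_fun [set: Omega] (Y n) by exact: measurable_ladder_term.
split; [exact: measurable_initial_tuple|exact: mY| |].
  by move=> A mA; exact: measurable_kernel.
move=> A B mA mB.
rewrite (ladder_joint mle XQ F_gt0 alpha_gt0 rate mA mB).
have mK : measurable_fun setT ((past_kernel ^~ A) \_ B).
  apply/(measurable_restrictT _ mB); apply: measurable_funTS.
  exact: measurable_kernel.
have K0 y : 0 <= ((past_kernel ^~ A) \_ B) y by rewrite patchE; case: ifP.
rewrite [RHS]integral_mkcond (ge0_integral_pushforward mY P measurableT mK)//.
rewrite preimage_setT.
rewrite (integral_pdf mY (ladder_pdf mle XQ F_gt0 alpha_gt0 rate n))//.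
- rewrite [LHS]integral_mkcond; apply: eq_integral => y _; rewrite !patchE.
  case: ifP => _; last by rewrite mul0e.
  have [c0|] := ltP 0 (cumul y).
    rewrite past_kernelE//.
    have cE := fineK (cumulative_fin_num y); set c := fine _ in cE *.
    have c_gt0 : (0 < c)%R by rewrite -lte_fin cE.
    rewrite -cE [RHS]muleAC -!EFinM; congr (_%:E * _).
    by rewrite [(_ * c)%R]mulrC -mulrA mulKf// gt_eqF.
  move=> c0; have cE : cumul y = 0 by apply/eqP; rewrite eq_le c0/= measure_ge0.
  rewrite cE mule0 mul0e mule0 (_ : power_measure lam n _ = 0) ?mule0//.
  apply/eqP; rewrite -measure_le0 -cE; apply: le_measure; rewrite ?inE.
  - by apply: measurableI => //; exact: measurable_chain_below.
  - exact: measurable_chain_below.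
  - exact: subIsetr.
- by move=> y; rewrite !fin_numM// cumulative_fin_num.
Qed.

End ladder_chain.

(** * Ladder variables of a constant rate distribution *)

Theorem proposition7 (R : realType) (d : Order.disp_t) (S : poTopType d)
    (lam : {measure set (borel S) -> \bar R})
    (d' : measure_display) (Omega : measurableType d') (P : probability Omega R)
    (X : nat -> {RV P >-> borel S}) (Q : probability (borel S) R) (alpha : R) :
  standard_poset lam ->
  iid X Q ->
  measure_support Q = [set: S] ->
  (forall x : S, 0 < upf Q x <= 1) ->
  constant_rate lam Q alpha ->
  let F : S -> R := upf Q in
  let Y : nat -> Omega -> borel S := ladder (fun i => X i) in
  [/\ exists K : R.-pker (borel S) ~> (borel S),
        homogeneous_markov_chain P Y K /\
        forall y : S,
          is_pdf lam (K y)
            (density_on [set z : S | (y <= z)%O]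
               (fun z => (alpha * (F z / F y))%:E)),
      forall n : nat,
        has_pdf P (initial_tuple Y n.+1) (product_power lam n.+1)
          (density_on (chain n.+1)
             (fun t => (alpha ^+ n.+1 * F (tnth t ord_max))%:E)),
      forall n : nat,
        has_pdf P (Y n) lam
          (fun y => (alpha ^+ n.+1)%:E * poset_cumulative lam n y * (F y)%:E)%E &
      forall n : nat,
        exists K : R.-pker (borel S) ~> (n.+1.-tuple (borel S)),
          [/\ cond_distribution P (initial_tuple Y n.+1) (Y n.+1)
                (fun y A => K y A),
              {ae pushforward P (Y n.+1), forall y : S,
                 (0 < poset_cumulative lam n.+1 y)%E} &
              forall y : S, (0 < poset_cumulative lam n.+1 y)%E ->
                is_pdf (product_power lam n.+1) (K y)
                  (density_on (chain_below n.+1 y)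
                     (fun=> ((fine (poset_cumulative lam n.+1 y))^-1)%:E))]].
Proof.
move=> std XQ _ F01 rate F Y.
have mle := measurable_order (std_second_countable std) (std_closed_order std).
have F_gt0 x : 0 < upf Q x by have /andP[] := F01 x.
have lam_sf := constant_rate_sigma_finite rate F_gt0 mle.
pose slam : {sigma_finite_measure set (borel S) -> \bar R} :=
  sf_measure lam_sf.
have [alpha_gt0 pdfQ] : 0 < alpha /\ is_pdf slam Q (fun x => (alpha * upf Q x)%:E).
  exact: rate.
have lam_down x : (slam [set t : S | (t <= x)%O] < +oo)%E.
  exact/(std_finite_compact std)/(std_compact_down std).
have powerE n : product_power lam n = power_measure slam n.
  exact/esym/power_measureE.
split.
- exists (ladder_kernel mle Q); split; first exact: ladder_markov.
  by move=> y; exact: ladder_kernel_pdf.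
- move=> n; split; first exact: measurable_initial_tuple.
  by rewrite powerE; exact: initial_tuple_pdf.
- move=> n; split; first exact: measurable_ladder_term.
  by rewrite /poset_cumulative powerE; exact: ladder_pdf.
- move=> n; exists (past_kernel mle slam n.+1).
  rewrite /poset_cumulative powerE; split.
  + exact: (past_kernel_cond mle XQ F_gt0 alpha_gt0 pdfQ lam_down n.+1).
  + exact: (cumulative_gt0_ae mle XQ F_gt0 alpha_gt0 pdfQ n.+1).
  + by move=> y; exact: past_kernel_pdf.
Qed.
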